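(* Let $G$ be a finite group acting smoothly on a closed smooth manifold $M$, and let $k\geq 2$ be an integer. Then equivariant Morse functions are generic in the $C^k$-topology: the set of $f\in C^\infty(M)^G$ that are Morse is open and dense in $C^\infty(M)^G$ with respect to the $C^k$-topology.
   Context: $C^\infty(M)$ denotes the space of smooth functions $M\to\mathbb{R}$; $G$ acts on it by $f^\sigma=f\circ\sigma$, and $C^\infty(M)^G$ is the fixed subspace, whose elements are called equivariant functions. The critical set is $\mathrm{crit}(f)=\{p\in M: df_p=0\}$. An element $f\in C^\infty(M)^G$ is an equivariant Morse function if for every $p\in\mathrm{crit}(f)$ the Hessian $\mathrm{Hess}_f(p):T_pM\times T_pM\to\mathbb{R}$ is nondegenerate. *)

(* Defs.v *)
From HB Require Import structures.
From mathcomp Require Import all_boot all_order all_algebra all_fingroup.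
From mathcomp Require Import all_classical all_reals all_analysis.

Set Implicit Arguments.
Unset Strict Implicit.
Unset Printing Implicit Defensive.

Import Order.TTheory GRing.Theory Num.Theory.
Import numFieldNormedType.Exports.

Local Open Scope classical_set_scope.
Local Open Scope ring_scope.

(** * Smooth functions on open subsets of R^n *)

(* [pderiv [:: i1; ...; im] f] is d/dx_i1 (... (d/dx_im f)). *)
Definition pderiv (R : realType) (n : nat) (s : seq 'I_n)
    (f : 'rV[R]_n -> R) : 'rV[R]_n -> R :=
  foldr (fun (i : 'I_n) (g : 'rV[R]_n -> R) (x : 'rV[R]_n) =>
           'D_(delta_mx 0 i) g x) f s.

(* C^oo on U (used for U open): the iterated partial derivatives of all orders
   are differentiable, hence continuous, at every point of U.  Since U is open,
   the values of f outside U are irrelevant. *)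
Definition smooth_on (R : realType) (n : nat) (U : set 'rV[R]_n)
    (f : 'rV[R]_n -> R) : Prop :=
  forall (s : seq 'I_n) (x : 'rV[R]_n), U x -> differentiable (pderiv s f) x.

Definition vsmooth_on (R : realType) (m n : nat) (U : set 'rV[R]_m)
    (F : 'rV[R]_m -> 'rV[R]_n) : Prop :=
  forall j : 'I_n, smooth_on U (fun x => F x 0 j).

(** * Smooth manifolds *)

(* A homeomorphism from the open set [cdom] of M onto the open set [cimg] of
   R^n; [cmap] and [cinv] are total functions, meaningful on [cdom] and [cimg]
   only. *)
Record chart (R : realType) (n : nat) (M : topologicalType) := Chart {
  cdom : set M ;
  cimg : set 'rV[R]_n ;
  cmap :> M -> 'rV[R]_n ;
  cinv : 'rV[R]_n -> M ;
  open_cdom : open cdom ;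
  open_cimg : open cimg ;
  cmap_img : forall x, cdom x -> cimg (cmap x) ;
  cinv_dom : forall y, cimg y -> cdom (cinv y) ;
  cmapK : forall x, cdom x -> cinv (cmap x) = x ;
  cinvK : forall y, cimg y -> cmap (cinv y) = y ;
  cmap_continuous : {within cdom, continuous cmap} ;
  cinv_continuous : {within cimg, continuous cinv}
}.

(* Exchanging c and d in [atlas_smooth] gives smoothness of the inverse of the
   transition map. *)
Record smooth_structure (R : realType) (n : nat) (M : topologicalType) :=
  SmoothStructure {
  atlas : set (chart R n M) ;
  atlas_cover : forall p : M, exists c, atlas c /\ cdom c p ;
  atlas_smooth : forall c d, atlas c -> atlas d ->
    vsmooth_on (cimg c `&` (cinv c @^-1` cdom d)) (d \o cinv c)
}.

Definition closed_manifold (M : topologicalType) : Prop :=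
  [/\ hausdorff_space M, @second_countable M & compact [set: M]].

Section SmoothMaps.
Context {R : realType} {n : nat} {M : topologicalType}.
Variable S : smooth_structure R n M.

Definition smooth (f : M -> R) : Prop :=
  forall c, atlas S c -> smooth_on (cimg c) (f \o cinv c).

Definition smooth_map (phi : M -> M) : Prop :=
  continuous phi /\
  forall c d, atlas S c -> atlas S d ->
    vsmooth_on (cimg c `&` ((phi \o cinv c) @^-1` cdom d))
               (d \o phi \o cinv c).

(** * Tangent vectors, critical points, Hessians, Morse functions *)

Definition chart_around (p : M) (c : chart R n M) : Prop :=
  atlas S c /\ cdom c p.

(* A tangent vector at p assigns to every chart around p a coordinate vector,
   in such a way that coordinate vectors are exchanged by the differentials of
   the transition maps.  The value of [tcoord] at other charts is junk. *)
Record tangent (p : M) := Tangent {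
  tcoord :> chart R n M -> 'rV[R]_n ;
  tcoordP : forall c d, chart_around p c -> chart_around p d ->
    tcoord d = 'd (d \o cinv c) (c p) (tcoord c)
}.

Definition tangent_zero (p : M) (v : tangent p) : Prop :=
  forall c, chart_around p c -> v c = 0.

Definition chart_at (p : M) : chart R n M := sval (cid (atlas_cover S p)).

(* df_p(v), computed in a chart around p; it does not depend on the chart. *)
Definition dfun (f : M -> R) (p : M) (v : tangent p) : R :=
  let c := chart_at p in 'D_(v c) (f \o cinv c) (c p).

Definition crit (f : M -> R) : set M :=
  [set p | forall v : tangent p, dfun f v = 0].

(* Hess_f(p)(v, w) = sum_(i, j) v_i w_j d^2 f / dx_i dx_j (p), computed in a
   chart around p; it does not depend on the chart when p is critical, which is
   the only case in which it is used. *)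
Definition hess (f : M -> R) (p : M) (v w : tangent p) : R :=
  let c := chart_at p in
  'D_(v c) (fun y : 'rV[R]_n => 'D_(w c) (f \o cinv c) y : R) (c p).

Definition nondegenerate (p : M) (B : tangent p -> tangent p -> R) : Prop :=
  forall v, (forall w, B v w = 0) -> tangent_zero v.

Definition morse (f : M -> R) : Prop :=
  forall p, crit f p -> nondegenerate (@hess f p).

End SmoothMaps.

(** * The space of smooth functions with the C^k-topology *)

(* The index k only serves to select the topology. *)
Record Cinf (R : realType) (n : nat) (M : topologicalType)
    (S : smooth_structure R n M) (k : nat) := MkCinf {
  Cinf_fun :> M -> R ;
  Cinf_smooth : smooth S Cinf_fun
}.

Section CkTopology.
Context {R : realType} {n : nat} {M : topologicalType}.
Variables (S : smooth_structure R n M) (k : nat).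


HB.instance Definition _ := gen_eqMixin (Cinf S k).
HB.instance Definition _ := gen_choiceMixin (Cinf S k).

Definition Ck_ball (c : chart R n M) (K : set 'rV[R]_n) (s : seq 'I_n)
    (e : R) (f : Cinf S k) : set (Cinf S k) :=
  [set g : Cinf S k | forall y, K y ->
    `|pderiv s (g \o cinv c) y - pderiv s (f \o cinv c) y| < e].

(* Uniform convergence, on the compact subsets of the charts, of the partial
   derivatives of order at most k. *)
Definition Ck_subbase : set (set (Cinf S k)) :=
  [set U | exists c K s e f,
    [/\ atlas S c, compact K /\ K `<=` cimg c, (size s <= k)%N, 0 < e
      & U = Ck_ball c K s e f]].

HB.instance Definition _ :=
  isSubBaseTopological.Build (Cinf S k) Ck_subbase id.

End CkTopology.

(** * Smooth actions and equivariant functions *)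

Section Actions.
Context {R : realType} {n : nat} {M : topologicalType}.
Variables (S : smooth_structure R n M) (G : finGroupType).
Variable act : {action G &-> M}.

(* [act] is a right action; the left action of s is [act^~ s^-1], which yields
   the same smooth actions and the same invariant functions. *)
Definition smooth_action : Prop := forall s : G, smooth_map S (act^~ s).

(* C^oo(M)^G, a subspace of C^oo(M) with the C^k-topology. *)
Definition equivariant_functions (k : nat) : set (Cinf S k) :=
  [set f : Cinf S k | forall s : G, f \o act^~ s = f].

End Actions.

Arguments equivariant_functions {R n M} S {G} act k.

(* Main.v *)
Require Import Defs.
From mathcomp Require Import finmap.
From mathcomp Require Import all_boot all_order all_algebra all_fingroup.
From mathcomp Require Import all_classical all_reals all_analysis.
From mathcomp Require Import ring lra zify.

Set Implicit Arguments.
Unset Strict Implicit.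
Unset Printing Implicit Defensive.

Import Order.TTheory GRing.Theory Num.Theory.
Import numFieldNormedType.Exports.

Local Open Scope classical_set_scope.
Local Open Scope ring_scope.

(** The condition that p is not a degenerate critical point only concerns the
    2-jet of the function at p, read in any chart around p: the gradient or the
    determinant of the Hessian is nonzero ([morseP], [regular_chart]).  These
    2-jets form an open set, so that regularity at p persists at the points near
    p, for the functions near f ([near_regular]); the compactness of M then gives
    openness.

    For density, let H be the stabilizer of p, acting in a chart around p, and
    let avg be the average over H of the local diffeomorphisms of this action.
    Its differential A at a point fixed by H is the projection onto the tangent
    space of the fixed set.  Two successive perturbations by invariant functions
    remove the degenerate critical points fixed by H near p ([local_density]).

    - Adding a small linear form a in the coordinates of avg makes the critical
      points nondegenerate along the fixed set, for a generic a
      ([generic_covector]).  This is a Sard theorem, proved by counting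
      ([sard_counting]): a pair of a point q and a covector a for which the
      perturbed function has a degenerate critical point at q depends on n
      parameters; a is a Lipschitz function of these and, in the direction of a
      null vector of the Hessian, it only varies to second order.  The covectors
      obtained in this way are too few to exhaust a fine grid.

    - Adding then t dev, where dev is the sum of the squared distances of the
      translates of a point to their average, leaves the derivatives along the
      fixed set unchanged and adds a form that is definite in the normal
      directions.  As the Hessians of invariant functions respect the
      decomposition given by A ([hessm_invariant]), the determinant is a nonzero
      polynomial in t ([det_near_neq0]).  The critical points concerned are
      isolated, so that by compactness all small t <> 0 are suitable.

    A cutoff followed by a sum over G turns avg and dev into smooth invariant
    functions on M ([equivariant_extension]).

    The global argument is an induction on the strata of the points whose
    stabilizer has at least m elements, which are closed, with m decreasing from
    the order of G to 0 ([dense_stratum]).  A function that is regular on the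
    stratum of index m + 1 is so near this stratum, and remains so when it is
    slightly changed.  Near a point whose stabilizer H has m elements, the
    stratum of index m consists of points fixed by H, to which the local result
    applies.  By compactness, finitely many local perturbations suffice, each of
    them so small that what the previous ones achieved persists. *)

(** * Calculus of partial derivatives *)

Section PartialDerivatives.
Context {R : realType}.

Definition pd n (i : 'I_n) (f : 'rV[R]_n -> R) : 'rV[R]_n -> R :=
  fun x => 'D_(delta_mx 0 i) f x.

Lemma derive_pd n (f : 'rV[R]_n -> R) (x v : 'rV[R]_n) :
  differentiable f x -> 'D_v f x = \sum_i v 0 i * pd i f x.
Proof.
move=> df; rewrite deriveE // {1}[v]row_sum_delta linear_sum /=.
by apply: eq_bigr => i _; rewrite linearZ /pd deriveE.
Qed.

Lemma differentiable_row (V : normedModType R) k (phi : V -> 'rV[R]_k) x :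
  (forall j, differentiable (fun y => phi y 0 j) x) -> differentiable phi x.
Proof.
move=> dphi.
have -> : phi = \sum_j (fun y => phi y 0 j *: (delta_mx 0 j : 'rV[R]_k)).
  by apply/funext => y; rewrite fct_sumE {1}[phi y]row_sum_delta.
by apply: differentiable_sum => j; exact: differentiableZl.
Qed.

Lemma pd_comp m k (F : 'rV[R]_k -> R) (phi : 'rV[R]_m -> 'rV[R]_k) x i :
  (forall j, differentiable (fun y => phi y 0 j) x) ->
  differentiable F (phi x) ->
  pd i (F \o phi) x = \sum_j pd i (fun y => phi y 0 j) x * pd j F (phi x).
Proof.
move=> dphi dF; have dp := differentiable_row dphi.
rewrite /pd deriveE; last exact: differentiable_comp.
rewrite diff_comp //= -deriveE // derive_pd //.
apply: eq_bigr => j _; congr (_ * _).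
by rewrite -deriveE // derive_mx ?mxE //; exact: diff_derivable.
Qed.

Lemma pd_ext n (U : set 'rV[R]_n) (f g : 'rV[R]_n -> R) i x :
  open U -> {in U, f =1 g} -> U x -> pd i f x = pd i g x.
Proof.
move=> oU fg Ux; apply: near_eq_derive.
by apply: filterS (open_nbhs_nbhs (conj oU Ux)) => y Uy; rewrite fg ?inE.
Qed.

(** The difference g - f vanishes near x, so that the zero map has the property
    that characterizes its differential. *)
Lemma differentiable_near_eq (V W : normedModType R) (f g : V -> W) x :
  {near x, f =1 g} -> differentiable f x -> differentiable g x.
Proof.
move=> fg df; have -> : g = f + (g - f) by rewrite addrC subrK.
apply: differentiableD => //.
pose k := g - f; have k0 : {near x, k =1 cst 0}.
  by near=> y; rewrite -[LHS]/(g y - f y); apply/eqP; rewrite subr_eq0 eq_sym;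
    apply/eqP; near: y.
have kshift : k \o shift x = cst (k x) + \0 +o_ 0 id.
  apply/eqaddoP => _ /posnumP[e].
  have := k0; rewrite (near_shift 0 x) subr0 => k0'.
  near=> h; rewrite !fctE /= (nbhs_singleton k0) /=.
  have -> : k (h + x) = 0 by near: h.
  by rewrite addr0 subr0 normr0 mulr_ge0.
have c0 : continuous (\0 : V -> W) by move=> y; exact: cst_continuous.
have dk0 := diff_unique c0 kshift.
by apply/diff_locallyP; rewrite dk0.
Unshelve. all: by end_near. Qed.

End PartialDerivatives.

(** * Smooth functions and cutoffs *)

Section FlatFunctions.
Context {R : realType}.

(** The functions x^-k exp(-1/x), extended by 0 to x <= 0: a family of flat
    functions stable under differentiation up to linear combinations. *)
Definition flat (k : nat) (x : R) : R :=
  if 0 < x then x ^- k * expR (- x^-1) else 0.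

(** exp(1/x) >= (1/(N x))^N for N = k + 2, since exp(t) >= t for t = 1/(N x). *)
Lemma flat_le k (x : R) : 0 < x -> `|flat k x| <= (k.+2)%:R ^+ k.+2 * x ^+ 2.
Proof.
move=> x0; rewrite /flat x0.
have N0 : 0 < (k.+2)%:R :> R by rewrite ltr0n.
have t0 : 0 < x^-1 / (k.+2)%:R by rewrite divr_gt0 // invr_gt0.
have ge : (x^-1 / (k.+2)%:R) ^+ k.+2 <= expR x^-1.
  have -> : expR x^-1 = expR (x^-1 / (k.+2)%:R) ^+ k.+2.
    by rewrite -expRM_natl mulrC divfK // gt_eqF.
  apply: lerXn2r; rewrite ?nnegrE ?ltW ?expR_gt0 //.
  by apply: lt_le_trans (expR_ge1Dx _); rewrite ltrDr.
rewrite ger0_norm; last by rewrite mulr_ge0 ?invr_ge0 ?exprn_ge0 ?expR_ge0 ?ltW.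
rewrite expRN ler_pdivrMr ?expR_gt0 //.
apply: le_trans (ler_wpM2l _ ge); last by rewrite mulr_ge0 ?exprn_ge0 ?ltW.
suff -> : x ^- k = (k.+2)%:R ^+ k.+2 * x ^+ 2 * (x^-1 / (k.+2)%:R) ^+ k.+2 by [].
rewrite exprMn !exprVn; set P := (k.+2)%:R ^+ k.+2.
have P0 : P != 0 by rewrite expf_neq0 // gt_eqF.
have xk0 : x ^+ k != 0 by rewrite expf_neq0 // gt_eqF.
have x2k : x ^+ k.+2 = x ^+ 2 * x ^+ k by rewrite -exprD.
rewrite x2k; move: (x ^+ k) xk0 => xk xk0.
by field; rewrite xk0 P0 gt_eqF.
Qed.

Lemma flat_gt0 k (x : R) : 0 < x -> 0 < flat k x.
Proof. by move=> x0; rewrite /flat x0 mulr_gt0 ?invr_gt0 ?exprn_gt0 ?expR_gt0. Qed.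

Lemma flat_ge0 k (x : R) : 0 <= flat k x.
Proof.
by rewrite /flat; case: ifP => // x0; apply/ltW/mulr_gt0; rewrite ?invr_gt0 ?exprn_gt0 ?expR_gt0.
Qed.

Lemma flat_eq0 k (x : R) : x <= 0 -> flat k x = 0.
Proof. by rewrite leNgt /flat => /negbTE ->. Qed.

Lemma is_derive_flat k (x : R) :
  is_derive x 1 (flat k) (flat k.+2 x - k%:R * flat k.+1 x).
Proof.
have [x0|x0|->] := ltgtP x 0.
- rewrite (flat_eq0 k.+2) ?(flat_eq0 k.+1) ?ltW // mulr0 subr0.
  apply: (@near_eq_is_derive _ _ _ (cst 0)).
  by near=> y; rewrite /= flat_eq0 // ltW //; near: y; exact: lt_nbhsl.
- have xn0 : x != 0 by rewrite gt_eqF.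
  apply: (@near_eq_is_derive _ _ _ (fun y : R => (y^-1) ^+ k * expR (- y^-1))).
    near=> y; rewrite /flat; have -> : 0 < y by near: y; exact: lt_nbhsr.
    by rewrite exprVn.
  have dV : is_derive x 1 (fun y : R => y^-1) (- x ^- 2).
    have dx := @derivable_id R _ x 1.
    split; first exact: (@derivableV R _ id x 1 xn0 dx).
    by rewrite (@deriveV R _ id x 1 xn0 dx) derive_id [LHS]mulr1.
  have dX := @is_deriveX _ _ (fun y : R => y^-1) k x 1 _ dV.
  have dE := @is_derive1_comp R expR (fun y : R => - y^-1) x _ _
    (is_derive_expR (- x^-1)) (is_deriveN dV).
  rewrite [X in is_derive _ _ X _](_ : _ =
    (fun y : R => y^-1) ^+ k * (expR \o fun y : R => - y^-1)); last first.
    by apply/funext => y; rewrite mulrfctE exprfctE.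
  apply: is_derive_eq.
  rewrite !fctE /= /flat x0 opprK /GRing.scale /= !exprVn.
  have xk0 : x ^+ k != 0 by rewrite expf_neq0.
  case: k dX xk0 => [|k] _; first by rewrite /= !expr0 => _; field.
  rewrite /= !exprS !expr0 mulf_eq0 negb_or => /andP[_].
  by move: (x ^+ k) => xk xk0; field; rewrite xn0 xk0.
- rewrite (flat_eq0 k.+2) ?(flat_eq0 k.+1) // mulr0 subr0.
  set C := (k.+2)%:R ^+ k.+2 : R.
  have C0 : 0 < C by rewrite exprn_gt0 // ltr0n.
  have flim : (fun h : R => h^-1 *: (flat k (h *: 1 + 0) - flat k 0)) @ 0^' --> (0 : R).
    apply/cvgr0Pnorm_le => e e0; near=> h.
    have hn0 : h != 0 by near: h; exact: nbhs_dnbhs_neq.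
    rewrite (flat_eq0 k (lexx 0)) subr0 addr0 [h *: 1]mulr1 normrM normfV.
    have [h0|h0] := ltP 0 h; last by rewrite flat_eq0 // normr0 mulr0 ltW.
    rewrite ler_pdivrMl ?normr_gt0 // (le_trans (flat_le k h0)) // -/C.
    rewrite gtr0_norm // expr2 mulrCA ler_pM2l // mulrC -ler_pdivlMr //.
    rewrite (le_trans (ler_norm h)) // ltW //.
    near: h; apply: dnbhs0_lt; exact: divr_gt0.
  split; last exact: cvg_lim flim.
  by apply/cvg_ex; exists 0.
Unshelve. all: by end_near. Qed.


End FlatFunctions.

Section SmoothFunctions.
Context {R : realType}.

Lemma pderiv_rcons n (s : seq 'I_n) i (f : 'rV[R]_n -> R) :
  pderiv (rcons s i) f = pderiv s (pd i f).
Proof. by rewrite /pderiv foldr_rcons. Qed.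

Lemma pderiv_ext n (U : set 'rV[R]_n) (f g : 'rV[R]_n -> R) s x :
  open U -> {in U, f =1 g} -> U x -> pderiv s f x = pderiv s g x.
Proof.
move=> oU; elim/last_ind: s f g => [|s i IHs] f g fg Ux; first by rewrite /= fg ?inE.
rewrite !pderiv_rcons; apply: IHs => // y; rewrite inE => Uy.
exact: pd_ext oU fg Uy.
Qed.

Lemma smooth_on_differentiable n (U : set 'rV[R]_n) f x :
  smooth_on U f -> U x -> differentiable f x.
Proof. by move=> /(_ [::] x). Qed.

Lemma smooth_on_pd n (U : set 'rV[R]_n) f i : smooth_on U f -> smooth_on U (pd i f).
Proof. by move=> sf s x Ux; rewrite -pderiv_rcons; exact: sf. Qed.

Lemma smooth_on_sub n (U V : set 'rV[R]_n) f :
  U `<=` V -> smooth_on V f -> smooth_on U f.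
Proof. by move=> UV sf s x /UV; exact: sf. Qed.

Lemma near_eq_open (V : topologicalType) (W : Type) (U : set V) (f g : V -> W) x :
  open U -> {in U, f =1 g} -> U x -> {near x, f =1 g}.
Proof.
move=> oU fg Ux.
by apply: filterS (open_nbhs_nbhs (conj oU Ux)) => y Uy; apply: fg; rewrite inE.
Qed.

Lemma smooth_on_ext n (U : set 'rV[R]_n) (f g : 'rV[R]_n -> R) :
  open U -> {in U, f =1 g} -> smooth_on U f -> smooth_on U g.
Proof.
move=> oU fg sf s x Ux; apply: differentiable_near_eq (sf s x Ux).
apply: (near_eq_open oU) => // y; rewrite inE => Uy.
exact: pderiv_ext oU fg Uy.
Qed.

Lemma smooth_on_local n (U : set 'rV[R]_n) f :
  (forall x, U x -> exists V, V x /\ smooth_on V f) -> smooth_on U f.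
Proof. by move=> loc s x /loc [V [Vx sf]]; exact: sf. Qed.

(** Smoothness is coinductive: f is smooth when it belongs to a class of
    differentiable functions closed under partial derivatives. *)
Lemma smooth_on_coind n (U : set 'rV[R]_n) (X : ('rV[R]_n -> R) -> Prop) :
  (forall f, X f -> (forall x, U x -> differentiable f x) /\
                    (forall i, X (pd i f))) ->
  forall f, X f -> smooth_on U f.
Proof.
move=> Xd f Xf s; elim/last_ind: s f Xf => [|s i IHs] f Xf x Ux.
  exact: (Xd f Xf).1.
by rewrite pderiv_rcons; apply: IHs => //; exact: (Xd f Xf).2.
Qed.

(** The closure of the smooth functions on U under the operations used to build
    new ones.  The rule of differentiation of each operation shows that the
    partial derivatives stay in the class, so that all the closure properties
    of smoothness come from a single coinduction. *)
Inductive smooth_closure n (U : set 'rV[R]_n) : ('rV[R]_n -> R) -> Prop :=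
| sc_base f : smooth_on U f -> smooth_closure U f
| sc_ext f g : {in U, f =1 g} -> smooth_closure U f -> smooth_closure U g
| sc_add f g : smooth_closure U f -> smooth_closure U g ->
    smooth_closure U (f \+ g)
| sc_mul f g : smooth_closure U f -> smooth_closure U g ->
    smooth_closure U (f \* g)
| sc_comp k (V : set 'rV[R]_k) F (phi : 'rV[R]_n -> 'rV[R]_k) :
    smooth_on V F -> (forall x, U x -> V (phi x)) ->
    (forall j, smooth_closure U (fun x => phi x 0 j)) ->
    smooth_closure U (F \o phi)
| sc_flat k f : smooth_closure U f -> smooth_closure U (flat k \o f)
| sc_inv f : (forall x, U x -> f x != 0) -> smooth_closure U f ->
    smooth_closure U (fun x => (f x)^-1).

Lemma smooth_on_cst n (U : set 'rV[R]_n) (a : R) : smooth_on U (fun=> a).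
Proof.
apply: (@smooth_on_coind _ U (fun f => exists a : R, f = cst a)); last by exists a.
move=> f [b ->]; split=> [x _|i]; first exact: differentiable_cst.
by exists 0; apply/funext => x; rewrite /pd derive_cst.
Qed.

Lemma smooth_on_coord n (U : set 'rV[R]_n) (j : 'I_n) :
  smooth_on U (fun x => x 0 j).
Proof.
have dcoord x : differentiable (fun y : 'rV[R]_n => y 0 j : R) x.
  exact: differentiable_coord.
apply: (@smooth_on_coind _ U (fun f => (f = fun x => x 0 j) \/
   exists a : R, f = cst a)); last by left.
move=> f [->|[a ->]]; split=> [x _|i]; try exact: dcoord; try exact: differentiable_cst.
  right; exists ((delta_mx 0 i : 'rV[R]_n) 0 j); apply/funext => x.
  have := @derive_mx R _ 1 n (id : 'rV[R]_n -> _) x (delta_mx 0 i) (@derivable_id R _ x (delta_mx 0 i)).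
  by rewrite derive_id => /(congr1 (fun A : 'rV_n => A 0 j)); rewrite [RHS]mxE => ->.
by right; exists 0; apply/funext => x; rewrite /pd derive_cst.
Qed.

Lemma sc_sum n (U : set 'rV[R]_n) (I : Type) (r : seq I) (F : I -> 'rV[R]_n -> R) :
  (forall i, smooth_closure U (F i)) ->
  smooth_closure U (fun x => \sum_(i <- r) F i x).
Proof.
move=> sF; elim: r => [|i r IHr].
  apply: (@sc_ext _ _ (fun=> 0)); last by apply: sc_base; exact: smooth_on_cst.
  by move=> x _; rewrite big_nil.
apply: sc_ext (sc_add (sF i) IHr) => x _.
by rewrite big_cons.
Qed.

Lemma sc_scale n (U : set 'rV[R]_n) a f :
  smooth_closure U f -> smooth_closure U (fun x => a * f x).
Proof. by move=> sf; apply: (sc_mul _ sf); apply: sc_base; exact: smooth_on_cst. Qed.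

Lemma smooth_closureP n (U : set 'rV[R]_n) f : open U ->
  smooth_closure U f <-> smooth_on U f.
Proof.
move=> oU; split; last exact: sc_base.
move: f; apply: smooth_on_coind => f; elim => {f}.
- move=> f sf; split=> [x|i]; first exact: smooth_on_differentiable.
  by apply: sc_base; exact: smooth_on_pd.
- move=> f g fg _ [df sdf]; split=> [x Ux|i].
    by apply: differentiable_near_eq (df x Ux); exact: near_eq_open oU fg Ux.
  by apply: sc_ext (sdf i) => x; rewrite inE => Ux; exact: pd_ext oU fg Ux.
- move=> f g _ [df sdf] _ [dg sdg]; split=> [x Ux|i].
    by apply: differentiableD; [exact: df|exact: dg].
  apply: sc_ext (sc_add (sdf i) (sdg i)) => x; rewrite inE => Ux.
  by rewrite /= /pd deriveD //; apply: diff_derivable; [exact: df|exact: dg].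
- move=> f g sf [df sdf] sg [dg sdg]; split=> [x Ux|i].
    by apply: differentiableM; [exact: df|exact: dg].
  apply: sc_ext (sc_add (sc_mul sf (sdg i)) (sc_mul sg (sdf i))) => x.
  rewrite inE => Ux.
  by rewrite /= /pd deriveM //; apply: diff_derivable; [exact: df|exact: dg].
- move=> k V F phi sF UV sphi IHphi; split=> [x Ux|i].
    apply: differentiable_comp; last exact: smooth_on_differentiable sF (UV _ Ux).
    by apply: differentiable_row => j; exact: (IHphi j).1.
  apply: (@sc_ext _ _ (fun x => \sum_j pd i (fun y => phi y 0 j) x * pd j F (phi x))).
    move=> x; rewrite inE => Ux; rewrite pd_comp //.
      by move=> j; exact: (IHphi j).1.
    exact: smooth_on_differentiable sF (UV _ Ux).
  apply: sc_sum => j; apply: (sc_mul ((IHphi j).2 i)).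
  by apply: (sc_comp (V := V)) => //; exact: smooth_on_pd.
- move=> k f sf [df sdf].
  have dflat y : differentiable (flat k : R -> R) y.
    by apply/derivable1_diffP; have := is_derive_flat k y => -[].
  split=> [x Ux|i]; first by apply: differentiable_comp; [exact: df|].
  apply: (@sc_ext _ _ (fun x => (flat k.+2 (f x) + (- k%:R) * flat k.+1 (f x)) * pd i f x)).
    move=> x; rewrite inE => Ux.
    rewrite /pd [RHS]deriveE; last by apply: differentiable_comp; [exact: df|].
    rewrite diff_comp //=; last exact: df.
    rewrite -(deriveE _ (df _ Ux)) -[X in 'd (flat k) _ X]mulr1.
    rewrite [X in 'd _ _ X](_ : _ = 'D_(delta_mx 0 i) f x *: (1 : R)) //.
    rewrite linearZ -deriveE //=.
    have -> : 'D_1 (flat k) (f x) = flat k.+2 (f x) - k%:R * flat k.+1 (f x).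
      by have := is_derive_flat k (f x) => -[].
    by rewrite mulNr mulrC.
  apply: sc_mul => //; apply: sc_add; first exact: sc_flat.
  by apply: sc_scale; exact: sc_flat.
- move=> f fn0 sf [df sdf]; split=> [x Ux|i].
    by apply: differentiableV; [exact: df|exact: fn0].
  apply: (@sc_ext _ _ (fun x => (-1) * ((f x)^-1 * ((f x)^-1 * pd i f x)))).
    move=> x; rewrite inE => Ux; rewrite /pd deriveV //; last first.
    - by apply: diff_derivable; exact: df.
    - exact: fn0.
    by rewrite /GRing.scale /= expr2 invfM mulN1r mulNr mulrA.
  by apply: sc_scale; apply: sc_mul; [|apply: sc_mul => //]; exact: sc_inv.
Qed.

End SmoothFunctions.

Section Cutoffs.
Context {R : realType}.

Lemma sc_cst n (U : set 'rV[R]_n) (a : R) : smooth_closure U (fun=> a).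
Proof. by apply: sc_base; exact: smooth_on_cst. Qed.

Lemma sc_coord n (U : set 'rV[R]_n) j : smooth_closure U (fun x => x 0 j).
Proof. by apply: sc_base; exact: smooth_on_coord. Qed.

Lemma sc_prod n (U : set 'rV[R]_n) (I : Type) (r : seq I) (F : I -> 'rV[R]_n -> R) :
  (forall i, smooth_closure U (F i)) ->
  smooth_closure U (fun x => \prod_(i <- r) F i x).
Proof.
move=> sF; elim: r => [|i r IHr].
  by apply: sc_ext (sc_cst _ 1) => x _; rewrite big_nil.
by apply: sc_ext (sc_mul (sF i) IHr) => x _; rewrite big_cons.
Qed.

Definition step (t : R) : R := flat 0 t / (flat 0 t + flat 0 (1 - t)).

Lemma step_den (t : R) : 0 < flat 0 t + flat 0 (1 - t).
Proof.
have [t0|t0] := ltP 0 t.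
  by apply: ltr_wpDr; [exact: flat_ge0|exact: flat_gt0].
apply: ltr_wpDl; first exact: flat_ge0.
by apply: flat_gt0; lra.
Qed.

Lemma step_eq1 (t : R) : 1 <= t -> step t = 1.
Proof.
move=> t1; rewrite /step (@flat_eq0 _ 0 (1 - t)) ?subr_le0 // addr0 divff //.
by rewrite gt_eqF // flat_gt0 // (lt_le_trans ltr01).
Qed.

Lemma step_eq0 (t : R) : t <= 0 -> step t = 0.
Proof. by move=> t0; rewrite /step flat_eq0 // mul0r. Qed.

Lemma sc_step n (U : set 'rV[R]_n) f :
  smooth_closure U f -> smooth_closure U (step \o f).
Proof.
move=> sf; apply: (sc_mul (sc_flat 0 sf)).
apply: sc_inv => [x _|]; first by rewrite gt_eqF // step_den.
apply: (sc_add (sc_flat 0 sf) (sc_flat 0 (f := fun x => 1 - f x) _)).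
apply: sc_ext (sc_add (sc_cst _ 1) (sc_scale (-1) sf)) => x _.
by rewrite /= mulN1r.
Qed.

Lemma norm_rV_le n (x : 'rV[R]_n) (e : R) : 0 <= e ->
  (`|x| <= e) <-> (forall i, `|x 0 i| <= e).
Proof.
move=> e0; rewrite [X in X <= _]mx_normrE; split=> [xe i|xe].
  by apply: le_trans xe; apply: (le_bigmax _ (fun i => `|x i.1 i.2|) (0, i)).
by apply: bigmax_le => // -[i j] _; rewrite ord1.
Qed.

(** The cutoff is a product over the coordinates because the norm is the
    supremum norm. *)
Lemma smooth_bump n (y : 'rV[R]_n) (r : R) : 0 < r ->
  exists chi : 'rV[R]_n -> R, [/\ smooth_on setT chi,
    (forall x, `|x - y| <= r -> chi x = 1) &
    (forall x, 2 * r < `|x - y| -> chi x = 0)].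
Proof.
move=> r0.
exists (fun x => \prod_i (step (2 - r^-1 * (x 0 i - y 0 i)) *
                          step (2 + r^-1 * (x 0 i - y 0 i)))); split.
- apply/smooth_closureP; first exact: openT.
  have sl i (a : R) : smooth_closure setT (fun x : 'rV[R]_n => a * (x 0 i - y 0 i)).
    apply: sc_scale; exact: (sc_add (sc_coord _ i) (sc_cst _ (- y 0 i))).
  apply: sc_prod => i; apply: sc_mul.
    apply: (@sc_step _ _ (fun x => 2 - r^-1 * (x 0 i - y 0 i))).
    apply: sc_ext (sc_add (sc_cst _ 2) (sl i (- r^-1))) => x _.
    by rewrite /= mulNr.
  apply: (@sc_step _ _ (fun x => 2 + r^-1 * (x 0 i - y 0 i))).
  exact: (sc_add (sc_cst _ 2) (sl i r^-1)).
- move=> x /(norm_rV_le _ (ltW r0)) xy; apply: big1 => i _.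
  have := xy i; rewrite !mxE ler_norml => /andP[l u].
  have : r^-1 * (x 0 i - y 0 i) <= 1 by rewrite ler_pdivrMl // mulr1.
  have : - 1 <= r^-1 * (x 0 i - y 0 i) by rewrite ler_pdivlMl // mulrN1.
  by move=> ? ?; rewrite !step_eq1 ?mulr1 //; lra.
- move=> x xy.
  have [i xi] : exists i, 2 * r < `|x 0 i - y 0 i|.
    apply/not_existsP => H; move: xy; rewrite ltNge => /negP; apply.
    apply/norm_rV_le; first by rewrite mulr_ge0 // ltW.
    by move=> i; rewrite !mxE leNgt; apply/negP; exact: H.
  rewrite (bigD1 i) //=; set d := x 0 i - y 0 i in xi *.
  suff [] : r^-1 * d < -2 \/ 2 < r^-1 * d.
  + by move=> ?; rewrite (step_eq0 (_ : 2 + r^-1 * d <= 0)) ?mulr0 ?mul0r //; lra.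
  + by move=> ?; rewrite (step_eq0 (_ : 2 - r^-1 * d <= 0)) ?mul0r //; lra.
  rewrite ltr_pdivrMl // ltr_pdivlMl //.
  by move: xi; rewrite lter_normr => /orP[] xi; [right|left]; lra.
Qed.

End Cutoffs.

(** * Gradients and Hessians under composition *)

Section FirstAndSecondDerivatives.
Context {R : realType}.

Definition grad n (F : 'rV[R]_n -> R) (x : 'rV[R]_n) : 'rV[R]_n :=
  \row_i pd i F x.

Definition hessm n (F : 'rV[R]_n -> R) (x : 'rV[R]_n) : 'M[R]_n :=
  \matrix_(i, j) pd i (pd j F) x.

(** Vectors being rows, the differential is v |-> v *m jacm phi x: this is the
    transpose of the usual Jacobian matrix. *)
Definition jacm m k (phi : 'rV[R]_m -> 'rV[R]_k) (x : 'rV[R]_m) : 'M[R]_(m, k) :=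
  \matrix_(i, j) pd i (fun y => phi y 0 j) x.

(** The 2-jets of F at x that the Morse condition allows. *)
Definition regular_at n (F : 'rV[R]_n -> R) (x : 'rV[R]_n) : Prop :=
  grad F x != 0 \/ \det (hessm F x) != 0.

Lemma pdD n (f g : 'rV[R]_n -> R) i x :
  differentiable f x -> differentiable g x ->
  pd i (fun y => f y + g y) x = pd i f x + pd i g x.
Proof. by move=> df dg; rewrite /pd deriveD //; exact: diff_derivable. Qed.

Lemma pdM n (f g : 'rV[R]_n -> R) i x :
  differentiable f x -> differentiable g x ->
  pd i (fun y => f y * g y) x = f x * pd i g x + g x * pd i f x.
Proof. by move=> df dg; rewrite /pd deriveM //; exact: diff_derivable. Qed.

Lemma pd_cst n (a : R) i (x : 'rV[R]_n) : pd i (fun=> a) x = 0.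
Proof. exact: derive_cst. Qed.

Lemma pdZ n a (f : 'rV[R]_n -> R) i x :
  differentiable f x -> pd i (fun y => a * f y) x = a * pd i f x.
Proof.
by move=> df; rewrite pdM ?pd_cst ?mulr0 ?addr0 //; exact: differentiable_cst.
Qed.

Lemma differentiable_bigsum n (I : Type) (r : seq I) (f : I -> 'rV[R]_n -> R) x :
  (forall k, differentiable (f k) x) ->
  differentiable (fun y => \sum_(k <- r) f k y) x.
Proof.
move=> df; elim: r => [|k r IHr].
  rewrite (_ : (fun _ => _) = cst 0); first exact: differentiable_cst.
  by apply/funext => y; rewrite big_nil.
rewrite (_ : (fun _ => _) = f k + fun y => \sum_(k <- r) f k y).
  exact: differentiableD.
by apply/funext => y; rewrite big_cons.
Qed.

Lemma pd_sum n (I : Type) (r : seq I) (f : I -> 'rV[R]_n -> R) i x :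
  (forall k, differentiable (f k) x) ->
  pd i (fun y => \sum_(k <- r) f k y) x = \sum_(k <- r) pd i (f k) x.
Proof.
move=> df; elim: r => [|k r IHr].
  rewrite big_nil -[RHS](pd_cst 0 i x); congr (pd i _ x).
  by apply/funext => y; rewrite big_nil.
rewrite big_cons -IHr -pdD //; last exact: differentiable_bigsum.
by congr (pd i _ x); apply/funext => y; rewrite big_cons.
Qed.

Lemma grad_ext n (U : set 'rV[R]_n) f g x :
  open U -> {in U, f =1 g} -> U x -> grad f x = grad g x.
Proof. by move=> oU fg Ux; apply/rowP => i; rewrite !mxE; exact: pd_ext oU fg Ux. Qed.

Lemma hessm_ext n (U : set 'rV[R]_n) f g x :
  open U -> {in U, f =1 g} -> U x -> hessm f x = hessm g x.
Proof.
move=> oU fg Ux; apply/matrixP => i j; rewrite [LHS]mxE [RHS]mxE.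
by apply: (pd_ext i oU _ Ux) => y; rewrite inE => Uy; exact: pd_ext oU fg Uy.
Qed.

Lemma jacm_ext m k (U : set 'rV[R]_m) (f g : 'rV[R]_m -> 'rV[R]_k) x :
  open U -> {in U, f =1 g} -> U x -> jacm f x = jacm g x.
Proof.
move=> oU fg Ux; apply/matrixP => i j; rewrite !mxE.
by apply: (pd_ext i oU _ Ux) => y Uy; rewrite fg.
Qed.

Lemma regular_at_ext n (U : set 'rV[R]_n) f g x :
  open U -> {in U, f =1 g} -> U x -> regular_at f x -> regular_at g x.
Proof.
by move=> oU fg Ux; rewrite /regular_at (grad_ext oU fg Ux) (hessm_ext oU fg Ux).
Qed.

Lemma grad_comp m k (F : 'rV[R]_k -> R) (phi : 'rV[R]_m -> 'rV[R]_k) x :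
  (forall j, differentiable (fun y => phi y 0 j) x) ->
  differentiable F (phi x) ->
  grad (F \o phi) x = grad F (phi x) *m (jacm phi x)^T.
Proof.
move=> dphi dF; apply/rowP => i; rewrite !mxE pd_comp //.
by apply: eq_bigr => j _; rewrite !mxE mulrC.
Qed.

Lemma jacm_comp m k l (psi : 'rV[R]_k -> 'rV[R]_l) (phi : 'rV[R]_m -> 'rV[R]_k) x :
  (forall j, differentiable (fun y => phi y 0 j) x) ->
  (forall j, differentiable (fun y => psi y 0 j) (phi x)) ->
  jacm (psi \o phi) x = jacm phi x *m jacm psi (phi x).
Proof.
move=> dphi dpsi; apply/matrixP => i j; rewrite !mxE.
have := pd_comp i dphi (dpsi j).
rewrite /comp => ->.
by apply: eq_bigr => h _; rewrite !mxE.
Qed.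

(** The second derivatives of phi only occur multiplied by the gradient of F. *)
Lemma hessm_comp m k (U : set 'rV[R]_m) (V : set 'rV[R]_k)
    (F : 'rV[R]_k -> R) (phi : 'rV[R]_m -> 'rV[R]_k) x :
  open U -> vsmooth_on U phi -> smooth_on V F ->
  (forall y, U y -> V (phi y)) -> U x -> grad F (phi x) = 0 ->
  hessm (F \o phi) x = jacm phi x *m hessm F (phi x) *m (jacm phi x)^T.
Proof.
move=> oU sphi sF UV Ux gF; apply/matrixP => i j.
have dphi y l : U y -> differentiable (fun y => phi y 0 l) y.
  by move=> Uy; exact: smooth_on_differentiable (sphi l) Uy.
have dpphi y l : U y -> differentiable (pd j (fun y => phi y 0 l)) y.
  by move=> Uy; exact: smooth_on_differentiable (smooth_on_pd j (sphi l)) Uy.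
have dpF y l : U y -> differentiable (pd l F \o phi) y.
  move=> Uy; apply: differentiable_comp.
    by apply: differentiable_row => h; exact: dphi.
  exact: smooth_on_differentiable (smooth_on_pd l sF) (UV _ Uy).
rewrite [LHS]mxE.
rewrite (pd_ext (g := fun y => \sum_l pd j (fun y => phi y 0 l) y * (pd l F \o phi) y) i oU _ Ux).
  rewrite pd_sum; last first.
    by move=> l; apply: differentiableM; [exact: dpphi|exact: dpF].
  rewrite [RHS]mxE; apply: eq_bigr => l _.
  rewrite pdM; [|exact: dpphi|exact: dpF].
  have -> : (pd l F \o phi) x = 0.
    by move/rowP: gF => /(_ l); rewrite !mxE.
  rewrite mul0r addr0 pd_comp; [|by move=> h; exact: dphi|]; last first.
    exact: smooth_on_differentiable (smooth_on_pd l sF) (UV _ Ux).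
  rewrite !mxE mulrC; congr (_ * _).
  by apply: eq_bigr => h _; rewrite !mxE.
move=> y; rewrite inE => Uy; rewrite pd_comp //.
  by move=> h; exact: dphi.
exact: smooth_on_differentiable sF (UV _ Uy).
Qed.

(** At a critical point of F, the determinant of the Hessian of F o phi is a
    multiple of that of the Hessian of F. *)
Lemma regular_at_comp m (U V : set 'rV[R]_m)
    (F : 'rV[R]_m -> R) (phi : 'rV[R]_m -> 'rV[R]_m) x :
  open U -> vsmooth_on U phi -> smooth_on V F ->
  (forall y, U y -> V (phi y)) -> U x ->
  regular_at (F \o phi) x -> regular_at F (phi x).
Proof.
move=> oU sphi sF UV Ux reg.
have [gF|] := eqVneq (grad F (phi x)) 0; last by left.
have dF := smooth_on_differentiable sF (UV _ Ux).
have dphi l : differentiable (fun y => phi y 0 l) x.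
  exact: smooth_on_differentiable (sphi l) Ux.
right; case: reg; first by rewrite grad_comp // gF mul0mx eqxx.
rewrite (hessm_comp oU sphi sF UV Ux gF) !det_mulmx.
by rewrite !mulf_eq0 !negb_or => /andP[/andP[]].
Qed.

End FirstAndSecondDerivatives.

(** * Critical points in charts *)

Section Charts.
Context {R : realType} {n : nat} {M : topologicalType}.
Variable S : smooth_structure R n M.
Implicit Types (c d : chart R n M) (p : M) (f : M -> R).

Lemma cmap_cvg c p : cdom c p -> {for p, continuous c}.
Proof.
move=> cp; have := @cmap_continuous _ _ _ c.
by rewrite continuous_open_subspace; [apply; rewrite inE|exact: open_cdom].
Qed.

Lemma cinv_cvg c y : cimg c y -> {for y, continuous (cinv c)}.
Proof.
move=> cy; have := @cinv_continuous _ _ _ c.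
by rewrite continuous_open_subspace; [apply; rewrite inE|exact: open_cimg].
Qed.

Lemma nbhs_cimg c y : cimg c y -> nbhs y (cimg c).
Proof. by move=> cy; apply: open_nbhs_nbhs; split=> //; exact: open_cimg. Qed.

Lemma nbhs_cdom c p : cdom c p -> nbhs p (cdom c).
Proof. by move=> cp; apply: open_nbhs_nbhs; split=> //; exact: open_cdom. Qed.

Lemma nbhs_chart c p (A : set M) :
  cdom c p -> nbhs p A -> nbhs (c p) (cimg c `&` (cinv c @^-1` A)).
Proof.
move=> cp pA; apply: filterI; first exact/nbhs_cimg/cmap_img.
by apply: cinv_cvg; [exact: cmap_img|rewrite cmapK].
Qed.

Lemma open_chart_preimage c (A : set M) :
  open A -> open (cimg c `&` (cinv c @^-1` A)).
Proof.
move=> oA; rewrite openE => y [cy Ay]; rewrite /interior.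
apply: filterI; first exact: nbhs_cimg.
by apply: cinv_cvg => //; apply: open_nbhs_nbhs.
Qed.

Definition transition_dom c d := cimg c `&` (cinv c @^-1` cdom d).

Lemma open_transition_dom c d : open (transition_dom c d).
Proof. by apply: open_chart_preimage; exact: open_cdom. Qed.

Lemma transition_dom_cmap c d p : cdom c p -> cdom d p -> transition_dom c d (c p).
Proof. by move=> cp dp; split; [exact: cmap_img|rewrite /= cmapK]. Qed.

Lemma transitionK (T : Type) (f : M -> T) c d :
  {in transition_dom c d, (f \o cinv d) \o (d \o cinv c) =1 f \o cinv c}.
Proof. by move=> y; rewrite inE => -[cy dy] /=; rewrite cmapK. Qed.

Lemma vsmooth_on_differentiable m k (U : set 'rV[R]_m) (phi : 'rV[R]_m -> 'rV[R]_k) y :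
  vsmooth_on U phi -> U y -> differentiable phi y.
Proof.
move=> sphi Uy; apply: differentiable_row => j.
exact: smooth_on_differentiable (sphi j) Uy.
Qed.

Lemma transition_differentiable c d p :
  chart_around S p c -> chart_around S p d -> differentiable (d \o cinv c) (c p).
Proof.
move=> [ac cp] [ad dp].
apply: (vsmooth_on_differentiable (atlas_smooth ac ad)).
exact: transition_dom_cmap.
Qed.

Lemma diff_near_eq (V W : normedModType R) (f g : V -> W) x v :
  differentiable f x -> {near x, f =1 g} -> 'd f x v = 'd g x v.
Proof.
move=> df fg; rewrite -!deriveE //; last exact: differentiable_near_eq df.
exact: near_eq_derive.
Qed.

Lemma diff_comp_near_eq (U V W : normedModType R) (f : U -> V) (g : V -> W) h x y u :
  f x = y -> differentiable f x -> differentiable g y -> {near x, g \o f =1 h} ->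
  'd h x u = 'd g y ('d f x u).
Proof.
move=> <- df dg gfh.
have dgf := differentiable_comp df dg.
rewrite -(diff_near_eq u dgf gfh).
have -> := diff_comp df dg.
by [].
Qed.

(** The coordinates in the other charts are obtained from u by the differentials
    of the transition maps; the chain rule makes them compatible. *)
Lemma exists_tangent c p (u : 'rV[R]_n) : chart_around S p c ->
  exists v : tangent S p, v c = u.
Proof.
move=> cp.
have vP d e : chart_around S p d -> chart_around S p e ->
    'd (e \o cinv c) (c p) u = 'd (e \o cinv d) (d p) ('d (d \o cinv c) (c p) u).
  move=> dp ep.
  have E : (d \o cinv c) (c p) = d p by rewrite /= cmapK //; case: cp.
  have d1 := transition_differentiable cp dp.
  have d2 := transition_differentiable dp ep.
  apply: (diff_comp_near_eq u E d1 d2).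
  have Ucd : transition_dom c d (c p).
    by apply: transition_dom_cmap; [case: cp|case: dp].
  exact: near_eq_open (@open_transition_dom c d) (@transitionK _ e c d) Ucd.
exists (Tangent vP) => /=.
have -> : 'd (c \o cinv c) (c p) u = 'd (id : 'rV[R]_n -> 'rV[R]_n) (c p) u.
  apply: diff_near_eq; first exact: transition_differentiable.
  apply: (near_eq_open (@open_cimg _ _ _ c)); last by apply: cmap_img; case: cp.
  by move=> y; rewrite inE => cy; rewrite /= cinvK.
by rewrite -deriveE // derive_id.
Qed.

(** Quantifying over all charts makes the definition directly usable in a chart
    suited to the situation; by [regular_chart] a single chart decides. *)
Definition regular f p :=
  forall c, chart_around S p c -> regular_at (f \o cinv c) (c p).

(** Regularity is transported by the transition maps. *)
Lemma regular_chart f p c : smooth S f -> chart_around S p c ->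
  regular_at (f \o cinv c) (c p) -> regular f p.
Proof.
move=> sf [ac cp] reg d [ad dp].
rewrite -[d p](_ : (d \o cinv c) (c p) = _); last by rewrite /= cmapK.
have oU := @open_transition_dom c d; have Up := transition_dom_cmap cp dp.
apply: (regular_at_comp oU (atlas_smooth ac ad) (sf d ad) _ Up).
  by move=> y [cy dy]; exact: cmap_img.
apply: regular_at_ext oU _ Up reg => y Uy.
by rewrite transitionK.
Qed.

Lemma chart_atP p : chart_around S p (chart_at S p).
Proof. by rewrite /chart_at; case: cid. Qed.

Lemma dfunE f p (v : tangent S p) : smooth S f ->
  dfun f v = \sum_i v (chart_at S p) 0 i *
                    grad (f \o cinv (chart_at S p)) (chart_at S p p) 0 i.
Proof.
move=> sf; have [ac cp] := chart_atP p.
rewrite /dfun derive_pd; last first.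
  by apply: smooth_on_differentiable (sf _ ac) _; exact: cmap_img.
by apply: eq_bigr => i _; rewrite mxE.
Qed.

Lemma hessE f p (v w : tangent S p) : smooth S f ->
  hess f v w = (v (chart_at S p) *m hessm (f \o cinv (chart_at S p)) (chart_at S p p)
                *m (w (chart_at S p))^T) 0 0.
Proof.
move=> sf; have [ac cp] := chart_atP p; rewrite /hess.
set c := chart_at S p in ac cp *; set F := f \o cinv c.
have sF : smooth_on (cimg c) F := sf _ ac.
have dpF j y : cimg c y -> differentiable (pd j F) y.
  by move=> cy; exact: smooth_on_differentiable (smooth_on_pd j sF) cy.
have cy := cmap_img cp.
have -> : 'D_(v c) (fun y => 'D_(w c) F y) (c p) =
          'D_(v c) (fun y => \sum_j w c 0 j * pd j F y) (c p).
  apply: near_eq_derive.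
  apply: (near_eq_open (@open_cimg _ _ _ c)) => // y; rewrite inE => Uy.
  by rewrite derive_pd //; exact: smooth_on_differentiable sF Uy.
have dZ j y : cimg c y -> differentiable (fun y => w c 0 j * pd j F y) y.
  by move=> Uy; apply: differentiableM; [exact: differentiable_cst|exact: dpF].
rewrite derive_pd; last by apply: differentiable_bigsum => j; exact: dZ.
rewrite -mulmxA [RHS]mxE; apply: eq_bigr => i _; congr (_ * _).
rewrite pd_sum; last by move=> j; exact: dZ.
rewrite mxE; apply: eq_bigr => j _.
rewrite pdZ; last exact: dpF.
by rewrite [LHS]mulrC; congr (_ * _); rewrite mxE.
Qed.

Lemma tangent_zeroP p (v : tangent S p) : v (chart_at S p) = 0 -> tangent_zero v.
Proof.
by move=> v0 d dp; rewrite (tcoordP v (chart_atP p) dp) v0 linear0.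
Qed.

(** Every row of coordinates comes from a tangent vector, so that df and the
    Hessian form vanish on the same vectors as the gradient and the Hessian
    matrix in the chart. *)
Lemma morseP f : smooth S f -> morse S f <-> forall p, regular f p.
Proof.
move=> sf; split=> [mf p|reg p cf v hv].
  have cp := chart_atP p; apply: (regular_chart sf cp).
  have [gF|] := eqVneq (grad (f \o cinv (chart_at S p)) (chart_at S p p)) 0; last by left.
  right; apply/negP => /eqP/eqP/det0P [u u0 uH].
  have [v vu] := exists_tangent u cp.
  have cf : crit S f p.
    by move=> w; rewrite dfunE // gF big1 // => i _; rewrite mxE mulr0.
  have vz : tangent_zero v.
    by apply: (mf p cf) => w; rewrite hessE // vu uH mul0mx mxE.
  by move: u0; rewrite -vu vz // eqxx.
have cp := chart_atP p; apply: tangent_zeroP.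
have gF : grad (f \o cinv (chart_at S p)) (chart_at S p p) = 0.
  apply/rowP => i; have [w wi] := exists_tangent (delta_mx 0 i) cp.
  have := cf w; rewrite dfunE // wi (bigD1 i) //= big1 ?addr0.
    by rewrite mxE !eqxx mul1r => ->; rewrite mxE.
  by move=> j ji; rewrite mxE (negbTE ji) andbF mul0r.
case: (reg p _ cp) => [|dH]; first by rewrite gF eqxx.
apply/eqP/negPn/negP => v0; move/det0P : dH; apply.
exists (v (chart_at S p)) => //; apply/rowP => j.
have [w wj] := exists_tangent (delta_mx 0 j) cp.
have := hv w; rewrite hessE // wj trmx_delta -colE.
by rewrite !mxE => ->.
Qed.

End Charts.

(** * The topology of order k and the openness of regularity *)

Section CkTopology.
Context {R : realType} {n : nat} {M : topologicalType}.
Variables (S : smooth_structure R n M) (k : nat).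

Lemma Ck_ball_nbhs c K s e (f0 f : Cinf S k) :
  atlas S c -> compact K -> K `<=` cimg c -> (size s <= k)%N -> 0 < e ->
  Ck_ball c K s e f0 f -> nbhs f (Ck_ball c K s e f0).
Proof.
move=> ac cK Kc sk e0 fB; apply: open_nbhs_nbhs; split=> //.
exists [set Ck_ball c K s e f0]; last by rewrite bigcup_set1.
move=> _ ->; exists (finmap.fset1 (Ck_ball c K s e f0)).
  move=> A; rewrite finmap.in_fset1 => /eqP ->; apply/mem_set.
  by exists c, K, s, e, f0.
apply/seteqP; split=> [g gB|g gB A /=]; first exact: (gB _ (finmap.fset11 _)).
by rewrite finmap.in_fset1 => /eqP ->.
Qed.

(** Convergence is tested on a subbase of the neighborhoods of the limit. *)
Lemma Ck_cvg (T : Type) (F : set_system T) (a : T -> Cinf S k) (f : Cinf S k) :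
  Filter F ->
  (forall c K s e (f0 : Cinf S k), atlas S c -> compact K -> K `<=` cimg c ->
     0 < e -> Ck_ball c K s e f0 f -> \forall t \near F, Ck_ball c K s e f0 (a t)) ->
  a @ F --> f.
Proof.
move=> FF near_ball A; rewrite nbhsE => -[B [[D DI <-] [C DC Cf]] BA].
have [E Esub EC] := DI _ DC.
have : \forall t \near F, C (a t).
  rewrite -EC.
  have nearX : forall X, X \in E -> F [set t | X (a t)].
    move=> X XE; have /set_mem[c [K [s [e [f0]]]]] := Esub _ XE.
    move=> [ac [cK Kc] _ e0 XB]; rewrite XB; apply: near_ball => //.
    by rewrite -XB; move: Cf; rewrite -EC => Cf; exact: Cf.
  have := filter_bigI FF nearX; apply: filterS => t Ht X XE.
  exact: (Ht X XE).
by apply: filterS => t Ct; apply: BA; exists C.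
Qed.

End CkTopology.

Section Determinant.
Context {R : realType}.

Lemma continuous_det n : continuous (fun A : 'M[R]_n => \det A).
Proof.
have cprod s : continuous (fun B : 'M[R]_n => \prod_i B i (perm.fun_of_perm s i)).
  apply: continuous_big => [|i _]; first exact: mul_continuous.
  exact: coord_continuous.
apply: continuous_big => [|s _ A]; first exact: add_continuous.
have c1 : (fun _ : 'M[R]_n => (-1) ^+ s : R) @ A --> ((-1) ^+ s : R).
  by apply: cvg_cst; exact: nbhs_filter.
exact: cvgM c1 (cprod s A).
Qed.

End Determinant.

Section OpenRegular.
Context {R : realType}.

Lemma regular_jet_near n (a0 : 'rV[R]_n) (H0 : 'M[R]_n) :
  a0 != 0 \/ \det H0 != 0 ->
  exists2 e, 0 < e & forall a H, `|a - a0| < e -> `|H - H0| < e ->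
    a != 0 \/ \det H != 0.
Proof.
case=> [a0n0|H0n0].
  exists `|a0|; first by rewrite normr_gt0.
  move=> a H aa0 _; left; apply: contraTneq aa0 => ->.
  by rewrite sub0r normrN ltxx.
have : \forall H \near H0, \det H != 0.
  exact: (@cvgr_neq0 _ _ _ _ (nbhs_filter H0) _ _ (@continuous_det R n H0) H0n0).
move=> /nbhs_ballP[e e0 He]; exists e => // a H _ HH0; right; apply: He.
by rewrite -ball_normE /ball_ /= distrC.
Qed.

Lemma mx_norm_lt m n (A : 'M[R]_(m, n)) e :
  0 < e -> (forall i j, `|A i j| < e) -> `|A| < e.
Proof. by move=> e0 Ae; rewrite [X in X < _]mx_normrE; apply: bigmax_lt => // -[i j] _ /=. Qed.

Lemma lt_split (e a b c : R) :
  0 < e -> `|a - b| < e / 2 -> `|b - c| < e / 2 -> `|a - c| < e.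
Proof.
move=> e0 ab bc; rewrite -(subrKA b) (splitr e).
by rewrite (le_lt_trans (ler_normD _ _)) // ltrD.
Qed.

Definition cube n (y : 'rV[R]_n) (r : R) : set 'rV[R]_n := [set x | `|x - y| <= r].

Lemma compact_cube n (y : 'rV[R]_n) r : 0 < r -> compact (cube y r).
Proof.
move=> r0; have -> : cube y r = closed_ball y r.
  rewrite closed_ballE // /closed_ball_ /cube; apply/funext => x /=.
  by rewrite distrC.
apply: bounded_closed_compact; last exact: closed_ball_closed.
rewrite closed_ballE //; exists (`|y| + r); split; first exact: num_real.
move=> m ym x /=; rewrite /closed_ball_ /= distrC => xy.
rewrite (le_trans _ (ltW ym)) // -[x](subrK y) addrC (le_trans (ler_normD _ _)) //.
by rewrite lerD2l.
Qed.

Lemma nbhs_cube n (y : 'rV[R]_n) r : 0 < r -> nbhs y (cube y r).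
Proof.
move=> r0; apply/nbhs_ballP; exists r => // x.
by rewrite -ball_normE /ball_ /= distrC => /ltW.
Qed.

Lemma cube_sub_nbhs n (y : 'rV[R]_n) (A : set 'rV[R]_n) :
  nbhs y A -> exists2 r, 0 < r & cube y r `<=` A.
Proof.
move=> /nbhs_ballP[r r0 rA]; exists (r / 2); first by rewrite divr_gt0.
move=> x; rewrite /cube /= => xy; apply: rA; rewrite -ball_normE /ball_ /= distrC.
by rewrite (le_lt_trans xy) // ltr_pdivrMr // ltr_pMr // ltr1n.
Qed.

Context {n : nat} {M : topologicalType}.
Variables (S : smooth_structure R n M) (k : nat).
Hypothesis k_ge2 : (2 <= k)%N.

(** Regularity only depends on the 2-jet, and the regular 2-jets form an open
    set. *)
Lemma near_regular (f : Cinf S k) (p : M) : regular S f p ->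
  \forall q \near p & g \near f, regular S (g : Cinf S k) q.
Proof.
move=> reg; pose c := chart_at S p.
have [ac cp] : chart_around S p c := chart_atP S p.
have [e e0 He] := regular_jet_near (reg c (conj ac cp)).
have [r r0 rc] := cube_sub_nbhs (nbhs_cimg (cmap_img cp)).
have e20 : 0 < e / 2 by rewrite divr_gt0.
pose near_f s (g : Cinf S k) := forall y, cube (c p) r y ->
  `|pderiv s (g \o cinv c) y - pderiv s (f \o cinv c) y| < e / 2.
pose near_p s (q : M) := 
  `|pderiv s (f \o cinv c) (c q) - pderiv s (f \o cinv c) (c p)| < e / 2.
have nf s : (size s <= k)%N -> \forall g \near f, near_f s g.
  move=> sk; apply: Ck_ball_nbhs => //; first exact: compact_cube.
  by move=> y _; rewrite subrr normr0.
have np s : \forall q \near p, near_p s q.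
  have dF : {for c p, continuous (pderiv s (f \o cinv c))}.
    apply: differentiable_continuous.
    by apply: (Cinf_smooth f ac); exact: cmap_img.
  have cF : {for p, continuous (pderiv s (f \o cinv c) \o c)}.
    by apply: continuous_comp => //; exact: cmap_cvg.
  by move/cvgrPdist_lt : cF => /(_ _ e20); apply: filterS => q; rewrite /= distrC.
have nf1 : \forall g \near f, forall i : 'I_n, near_f [:: i] g.
  by apply: (@filter_forall _ _ _ (nbhs f)) => i; apply: nf; exact: ltnW.
have nf2 : \forall g \near f, forall ij : 'I_n * 'I_n, near_f [:: ij.1; ij.2] g.
  by apply: (@filter_forall _ _ _ (nbhs f)) => ij; exact: nf.
have np1 : \forall q \near p, forall i : 'I_n, near_p [:: i] q.
  by apply: (@filter_forall _ _ _ (nbhs p)) => i; exact: np.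
have np2 : \forall q \near p, forall ij : 'I_n * 'I_n, near_p [:: ij.1; ij.2] q.
  by apply: (@filter_forall _ _ _ (nbhs p)) => ij; exact: np.
have nc : \forall q \near p, cube (c p) r (c q).
  by apply: (cmap_cvg cp); exact: nbhs_cube.
near=> q g.
have cq : cdom c q by near: q; exact: nbhs_cdom.
have g1 : forall i, near_f [:: i] g by near: g.
have g2 : forall ij : 'I_n * 'I_n, near_f [:: ij.1; ij.2] g by near: g.
have p1 : forall i, near_p [:: i] q by near: q.
have p2 : forall ij : 'I_n * 'I_n, near_p [:: ij.1; ij.2] q by near: q.
have cqr : cube (c p) r (c q) by near: q.
apply: (regular_chart (Cinf_smooth g) (conj ac cq)); apply: He.
  apply: (mx_norm_lt e0) => i j; rewrite !mxE.
  by apply: (lt_split e0); [exact: (g1 j _ cqr)|exact: p1].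
apply: (mx_norm_lt e0) => i j; rewrite !mxE.
by apply: (lt_split e0); [exact: (g2 (i, j) _ cqr)|exact: (p2 (i, j))].
Unshelve. all: by end_near. Qed.

(** The neighborhoods of f given by [near_regular] at the points of C are
    reduced to a single one by a covering argument. *)
Lemma near_regular_compact (C : set M) (f : Cinf S k) :
  compact C -> (forall p, C p -> regular S f p) ->
  \forall g \near f, forall p, C p -> regular S (g : Cinf S k) p.
Proof.
move=> /compact_near_coveringP cC reg.
by apply: (cC _ (nbhs f) (fun g p => regular S (g : Cinf S k) p)) => p /reg /near_regular.
Qed.

Lemma open_morse (G : finGroupType) (act : {action G &-> M}) :
  closed_manifold M ->
  open [set f : equivariant_functions S act k | morse S (set_val f)].
Proof.
case=> _ _ cM.
exists [set g : Cinf S k | forall p, regular S g p]; last first.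
  by apply/seteqP; split=> f /= /morseP; apply; exact: Cinf_smooth.
rewrite openE => f reg; rewrite /interior.
have := near_regular_compact cM (fun p _ => reg p).
by apply: filterS => g gr p; exact: gr.
Qed.

End OpenRegular.

(** * Small linear perturbations *)

Section Perturbation.
Context {R : realType} {n : nat} {M : topologicalType}.
Variables (S : smooth_structure R n M) (k : nat).

Definition lincomb m (f : M -> R) (u : 'I_m -> M -> R) (a : 'rV[R]_m) : M -> R :=
  fun p => f p + \sum_i a 0 i * u i p.

Lemma smooth_lincomb m f (u : 'I_m -> M -> R) a :
  smooth S f -> (forall i, smooth S (u i)) -> smooth S (lincomb f u a).
Proof.
move=> sf su c ac; apply/smooth_closureP; first exact: open_cimg.
apply: (sc_add (f := f \o cinv c)); first exact/sc_base/sf.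
apply: sc_sum => i; apply: (@sc_scale _ _ _ (a 0 i) (u i \o cinv c)).
exact/sc_base/su.
Qed.

Lemma pderivD (U : set 'rV[R]_n) (f g : 'rV[R]_n -> R) s y : open U ->
  smooth_on U f -> smooth_on U g -> U y ->
  pderiv s (f \+ g) y = pderiv s f y + pderiv s g y.
Proof.
move=> oU; elim/last_ind: s f g => [//|s i IHs] f g sf sg Uy.
rewrite !pderiv_rcons -IHs //; try exact: smooth_on_pd.
apply: (pderiv_ext s oU _ Uy) => z /set_mem Uz.
rewrite pdD //; first exact: smooth_on_differentiable sf Uz.
exact: smooth_on_differentiable sg Uz.
Qed.

Lemma pderiv_scale (U : set 'rV[R]_n) (f : 'rV[R]_n -> R) b s y : open U -> smooth_on U f -> U y ->
  pderiv s (fun x => b * f x) y = b * pderiv s f y.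
Proof.
move=> oU; elim/last_ind: s f => [//|s i IHs] f sf Uy.
rewrite !pderiv_rcons -IHs //; last exact: smooth_on_pd.
apply: (pderiv_ext s oU _ Uy) => z /set_mem Uz.
by rewrite pdZ //; exact: smooth_on_differentiable sf Uz.
Qed.

Lemma pderiv_sum (U : set 'rV[R]_n) (I : Type) (r : seq I) (f : I -> 'rV[R]_n -> R) s y :
  open U -> (forall i, smooth_on U (f i)) -> U y ->
  pderiv s (fun x => \sum_(i <- r) f i x) y = \sum_(i <- r) pderiv s (f i) y.
Proof.
move=> oU sf Uy; elim: r => [|i r IHr].
  rewrite big_nil (pderiv_ext (g := fun=> 0 * 0) s oU _ Uy); last first.
    by move=> z _; rewrite big_nil mulr0.
  by rewrite (pderiv_scale _ _ oU (@smooth_on_cst R n U 0) Uy) mul0r.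
rewrite big_cons -IHr -(pderivD _ oU) //; last first.
  by apply/smooth_closureP => //; apply: sc_sum => j; apply: sc_base.
by apply: (pderiv_ext s oU _ Uy) => z _; rewrite big_cons.
Qed.

Lemma pderiv_lincomb m c f (u : 'I_m -> M -> R) a s y :
  atlas S c -> smooth S f -> (forall i, smooth S (u i)) -> cimg c y ->
  pderiv s (lincomb f u a \o cinv c) y =
  pderiv s (f \o cinv c) y + \sum_i a 0 i * pderiv s (u i \o cinv c) y.
Proof.
move=> ac sf su cy; have oU := @open_cimg _ _ _ c.
have sau i : smooth_on (cimg c) (fun x => a 0 i * (u i \o cinv c) x).
  by apply/smooth_closureP => //; apply/sc_scale/sc_base; exact: su.
rewrite -[LHS]/(pderiv s ((f \o cinv c) \+ (fun x => \sum_i a 0 i * (u i \o cinv c) x)) y).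
rewrite (pderivD _ oU (sf _ ac) _ cy); last first.
  by apply/smooth_closureP => //; apply: sc_sum => i; exact: sc_base.
congr (_ + _); rewrite (pderiv_sum _ _ oU sau cy).
by apply: eq_bigr => i _; rewrite (pderiv_scale _ _ oU (su i _ ac) cy).
Qed.

(** The topology only tests finitely many derivatives on compact sets, so that
    small coefficients give small perturbations. *)
Lemma lincomb_cvg m (f : Cinf S k) (u : 'I_m -> M -> R)
    (su : forall i, smooth S (u i)) (T : Type) (F : set_system T) (a : T -> 'rV[R]_m) :
  Filter F -> a @ F --> (0 : 'rV[R]_m) ->
  (fun t => MkCinf k (smooth_lincomb (a t) (Cinf_smooth f) su)) @ F --> f.
Proof.
move=> FF a0; apply: Ck_cvg => c K s e f0 ac cK Kc e0 fB.
move/compact_near_coveringP : cK => cK.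
pose P t y := `|pderiv s (lincomb f u (a t) \o cinv c) y - pderiv s (f0 \o cinv c) y| < e.
suff : \forall t \near F, K `<=` P t by apply: filterS => t; exact.
apply: (cK _ F P) => y Ky; rewrite /P.
have cd (g : M -> R) : smooth S g -> {for y, continuous (pderiv s (g \o cinv c))}.
  move=> sg; apply: differentiable_continuous.
  by apply: (sg _ ac); exact: Kc.
pose h (z : 'rV[R]_n * T) := pderiv s (f \o cinv c) z.1 +
  \sum_i a z.2 0 i * pderiv s (u i \o cinv c) z.1 - pderiv s (f0 \o cinv c) z.1.
have hc : h @ (filter_prod (nbhs y) F) -->
    pderiv s (f \o cinv c) y - pderiv s (f0 \o cinv c) y.
  rewrite -[X in _ --> X - _]addr0.
  have fst_cvg (g : M -> R) : smooth S g ->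
      (fun z : 'rV[R]_n * T => pderiv s (g \o cinv c) z.1) @ (filter_prod (nbhs y) F)
      --> pderiv s (g \o cinv c) y.
    by move=> sg; apply: (@cvg_comp _ _ _ fst (pderiv s (g \o cinv c)) _ (nbhs y));
      [exact: cvg_fst|exact: cd].
  apply: cvgB; last exact/fst_cvg/Cinf_smooth.
  apply: cvgD; first exact/fst_cvg/Cinf_smooth.
  rewrite [X in _ --> X](_ : 0 = \sum_(i < m) 0 * pderiv s (u i \o cinv c) y); last first.
    by rewrite big1 // => i _; rewrite mul0r.
  have FFp : Filter (filter_prod (nbhs y) F) by exact: filter_prod_filter.
  apply: (@cvg_big R 'I_m +%R 0 xpredT (@add_continuous R) _ _ (index_enum 'I_m)
    (fun i z => a z.2 0 i * pderiv s (u i \o cinv c) z.1)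
    (fun i => 0 * pderiv s (u i \o cinv c) y) FFp) => i _.
  have acvg : (fun z : 'rV[R]_n * T => a z.2 0 i) @ filter_prod (nbhs y) F --> (0 : R).
    have ai : (fun x : 'rV[R]_m => x 0 i) @ (0 : 'rV[R]_m) --> (0 : R).
      have := @coord_continuous R 1 m 0 i (0 : 'rV[R]_m).
      by rewrite /continuous_at [X in _ --> X]mxE.
    apply: (@cvg_comp _ _ _ snd (fun t => a t 0 i) _ F); first exact: cvg_snd.
    exact: cvg_comp a0 ai.
  exact: cvgM acvg (fst_cvg _ (su i)).
have near_h : \forall z \near filter_prod (nbhs y) F, `|h z| < e.
  by apply: (cvgr_norm_lt _ hc); exact: fB.
have nc : \forall z \near filter_prod (nbhs y) F, cimg c z.1.
  exact: (cvg_fst (nbhs_cimg (Kc _ Ky))).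
apply: filterS2 nc near_h => -[y' t] /= cy'.
by rewrite /h /P pderiv_lincomb //; exact: Cinf_smooth.
Qed.

End Perturbation.

(** * A Sard theorem by counting *)

Section Counting.
Context {R : realType}.

(** The left-hand side grows like N^(2 n + 2) and the right-hand side like
    N^(2 n + 1). *)
Lemma pigeon_bound (K N n : nat) : (0 < K)%N -> (0 < N)%N ->
  ((N ^ 2) ^ n.+1 <=
    (2 * K * N).+1 ^ n.+1 * (2 * (K ^ 2 * N)).+1 ^ n * (2 * K ^ 2).+1)%N ->
  (N <= (3 * K) ^ n.+1 * (3 * K ^ 2) ^ n * (2 * K ^ 2).+1)%N.
Proof.
move=> K0 N0 le1.
have KN : (0 < K * N)%N by rewrite muln_gt0 K0.
have KKN : (0 < K ^ 2 * N)%N by rewrite muln_gt0 expn_gt0 K0.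
have le2 : ((2 * K * N).+1 ^ n.+1 <= (3 * K * N) ^ n.+1)%N.
  by rewrite leq_exp2r //; lia.
have le3 : ((2 * (K ^ 2 * N)).+1 ^ n <= (3 * K ^ 2 * N) ^ n)%N.
  by case: n le1 le2 => // n _ _; rewrite leq_exp2r //; lia.
have := leq_trans le1 (leq_mul (leq_mul le2 le3) (leqnn (2 * K ^ 2).+1)).
have -> : ((N ^ 2) ^ n.+1 = N * (N ^ n.+1 * N ^ n))%N.
  by rewrite -expnM -expnD -expnS; congr (_ ^ _)%N; lia.
have Np : (0 < N ^ n.+1 * N ^ n)%N by rewrite muln_gt0 !expn_gt0 N0.
move=> H; rewrite -(leq_pmul2r Np); apply: leq_trans H _.
apply: eq_leq; rewrite !expnMn; ring.
Qed.

(** Residues modulo B + 1 tell apart numbers at distance at most B. *)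
Lemma modn_close (B a b : nat) : (a <= b + B)%N -> (b <= a + B)%N ->
  (a = b %[mod B.+1])%N -> a = b.
Proof.
wlog ab : a b / (a <= b)%N.
  by move=> H; case: (leqP a b) => [|/ltnW] h h1 h2 E; [|apply/esym]; apply: H.
move=> _ bB /eqP; rewrite eq_sym eqn_mod_dvd // => /dvdn_leq dvd.
by have [|/dvd] := posnP (b - a)%N; lia.
Qed.

(** A Sard theorem by counting.  The points a range over a grid of mesh N^-2 in
    a cube, about N^(2 n) points.  The corresponding z fall into about N^n cells
    of size 1/N; those a that come from one cell lie in a ball of radius O(1/N)
    and within O(N^-2) of a hyperplane, so that there are O(N^(n-1)) of them.
    Altogether O(N^(2 n - 1)) grid points can be reached. *)
Lemma sard_counting n (Rel : 'rV[R]_n -> 'rV[R]_n -> Prop) (C l : R) : 0 < l ->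
  (forall z a, Rel z a -> `|z| <= C) ->
  (forall z a z' a', Rel z a -> Rel z' a' -> `|a' - a| <= C * `|z' - z|) ->
  (forall z a, Rel z a -> exists v : 'rV[R]_n, exists2 i, v 0 i = 1 &
     forall z' a', Rel z' a' ->
       `|\sum_j v 0 j * (a' - a) 0 j| <= C * `|z' - z| ^+ 2) ->
  exists2 a, `|a| <= l & forall z, ~ Rel z a.
Proof.
move=> l0 Cz Ca Cv.
case: n Rel Cz Ca Cv => [|n] Rel Cz Ca Cv.
  exists 0; first by rewrite normr0 ltW.
  by move=> z /Cv [v [[]]].
apply: contrapT => nex.
have ex a : `|a| <= l -> exists z, Rel z a.
  move=> al; apply: contrapT => nz; apply: nex; exists a => // z Rz.
  by apply: nz; exists z.
pose zf a : 'rV[R]_n.+1 := if pselect (`|a| <= l) is left h then sval (cid (ex a h)) else 0.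
have zfP a : `|a| <= l -> Rel (zf a) a.
  by rewrite /zf; case: pselect => // h _; case: cid.
(* A natural number K above both C and 1/l, to count with natural numbers. *)
have [K [Kp CK lK]] : exists K, [/\ (0 < K)%N, C <= K%:R & l^-1 <= K%:R].
  exists (Num.truncn C + Num.truncn l^-1).+1; split=> //.
    by rewrite (le_trans (ltW (truncnS_gt _))) // ler_nat ltnS leq_addr.
  by rewrite (le_trans (ltW (truncnS_gt _))) // ler_nat ltnS leq_addl.
pose N' := ((3 * K) ^ n.+1 * (3 * K ^ 2) ^ n * (2 * K ^ 2).+1)%N.
have [N NE] : exists N, N = N'.+1 by exists N'.+1.
have Np : (0 < N)%N by rewrite NE.
suff : (N <= N')%N by rewrite NE ltnn.
apply: pigeon_bound => //; clear NE N'.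
(* These bounds are made opaque so that finite types of that size can be
   handled without computing them. *)
have [cells cellsE] : exists c, c = (2 * K * N)%N by eexists.
have [W WE] : exists W, W = (2 * (K ^ 2 * N))%N by eexists.
have [B BE] : exists B, B = (2 * K ^ 2)%N by eexists.
rewrite -cellsE -WE -BE.
have N0 : 0 < N%:R :> R by rewrite ltr0n.
have K0 : 0 < K%:R :> R by rewrite ltr0n.
pose grid := {ffun 'I_n.+1 -> 'I_(N ^ 2)}.
pose a_ (m : grid) : 'rV[R]_n.+1 := \row_i (l * (m i)%:R / N%:R ^+ 2).
have a_l m : `|a_ m| <= l.
  rewrite [X in X <= _]mx_normrE; apply: bigmax_le => [|[? i] _ /=]; first exact: ltW.
  rewrite mxE ger0_norm; last first.
    by rewrite divr_ge0 ?exprn_ge0 // mulr_ge0 // ltW.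
  rewrite ler_pdivrMr ?exprn_gt0 // ler_pM2l // -natrX ler_nat.
  exact: ltnW.
have RelP m := zfP _ (a_l m).
pose z_ m := zf (a_ m).
pose cellr m i : R := (z_ m 0 i + K%:R) * N%:R.
have zK m i : `|z_ m 0 i| <= K%:R.
  apply: le_trans (le_trans (Cz _ _ (RelP m)) CK).
  by rewrite [leRHS]mx_normrE; apply: (le_bigmax _ (fun i => `|z_ m i.1 i.2|) (0, i)).
have cell_ge0 m i : 0 <= cellr m i.
  apply: mulr_ge0; last exact: ltW.
  by rewrite -lerBlDr sub0r; have := zK m i; rewrite ler_norml => /andP[].
have cell_lt m i : (Num.truncn (cellr m i) < cells.+1)%N.
  rewrite ltnS cellsE -(ler_nat R) (@le_trans _ _ (cellr m i)) ?truncn_le //.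
  rewrite /cellr natrM ler_pM2r // natrM mulr_natl mulr2n lerD2r.
  by have := zK m i; rewrite ler_norml => /andP[].
pose cell m : {ffun 'I_n.+1 -> 'I_cells.+1} := [ffun i => Ordinal (cell_lt m i)].
have cell_near m m' : cell m = cell m' -> `|z_ m - z_ m'| <= N%:R^-1.
  move=> cc; rewrite [X in X <= _]mx_normrE.
  apply: bigmax_le => [|[? i] _ /=]; first by rewrite invr_ge0 ltW.
  rewrite !mxE ord1; have : Num.truncn (cellr m i) = Num.truncn (cellr m' i).
    by have /(congr1 (fun f : {ffun _ -> _} => val (f i))) := cc; rewrite !ffunE.
  have /andP[l1 u1] := truncn_itv (cell_ge0 m i).
  have /andP[l2 u2] := truncn_itv (cell_ge0 m' i).
  move=> tt; rewrite tt in l1 u1.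
  have : `|cellr m i - cellr m' i| <= 1.
    by rewrite ler_norml -natr1 in u1 u2 *; lra.
  rewrite /cellr -mulrBl normrM (gtr0_norm N0) -ler_pdivlMr // mul1r.
  by congr (`|_| <= _); ring.
(* Each cell has a reference grid point, chosen by its class only. *)
pose ref m : grid := odflt m [pick m' | cell m' == cell m].
have ref_cell m : cell (ref m) = cell m.
  by rewrite /ref; case: pickP => [m' /eqP|_].
have ref_eq m m' : cell m = cell m' -> ref m = ref m'.
  by rewrite /ref => ->; case: pickP => // /(_ m'); rewrite eqxx.
have [vf vfP] := choice (fun m => Cv _ _ (RelP m)).
pose idx m := s2val (cid2 (vfP m)).
have v_idx m : vf m 0 (idx m) = 1 := s2valP (cid2 (vfP m)).
have v_flat m m' : `|\sum_j vf m 0 j * (a_ m' - a_ m) 0 j| <= C * `|z_ m' - z_ m| ^+ 2.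
  by apply: (s2valP' (cid2 (vfP m))); exact: RelP.
have a_diff m m' j : (a_ m' - a_ m) 0 j = l / N%:R ^+ 2 * ((m' j)%:R - (m j)%:R).
  by rewrite !mxE; field; rewrite gt_eqF.
have lN0 : 0 < l / N%:R ^+ 2 by rewrite divr_gt0 ?exprn_gt0.
have flat_near m m' : cell m' = cell m ->
    `|\sum_j vf m 0 j * ((m' j)%:R - (m j)%:R)| <= K%:R ^+ 2.
  move=> cc; have := v_flat m m'.
  have -> : \sum_j vf m 0 j * (a_ m' - a_ m) 0 j =
      l / N%:R ^+ 2 * \sum_j vf m 0 j * ((m' j)%:R - (m j)%:R).
    by rewrite mulr_sumr; apply: eq_bigr => j _; rewrite a_diff; ring.
  rewrite normrM (gtr0_norm lN0) mulrC -ler_pdivlMr // => /le_trans; apply.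
  rewrite ler_pdivrMr //.
  have : `|z_ m' - z_ m| ^+ 2 <= N%:R ^- 2.
    by rewrite -exprVn lerXn2r ?nnegrE ?invr_ge0 ?(ltW N0) // cell_near.
  move=> zz; apply: (@le_trans _ _ (K%:R * N%:R ^- 2)).
    apply: le_trans (ler_wpM2l (ltW K0) zz).
    by apply: ler_wpM2r => //; rewrite exprn_ge0.
  rewrite mulrA ler_pM2r ?invr_gt0 ?exprn_gt0 // expr2 -mulrA ler_pMr //.
  by rewrite -ler_pdivrMr // div1r.
have coord_near m m' j : cell m' = cell m -> `|(m' j)%:R - (m j)%:R| <= (K ^ 2 * N)%:R :> R.
  move=> cc; have aj : `|(a_ m' - a_ m) 0 j| <= K%:R * N%:R^-1.
    apply: (@le_trans _ _ `|a_ m' - a_ m|).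
      by rewrite [leRHS]mx_normrE; apply: (le_bigmax _ (fun i => `|(a_ m' - a_ m) i.1 i.2|) (0, j)).
    apply: le_trans (Ca _ _ _ _ (RelP m) (RelP m')) _.
    apply: le_trans (ler_wpM2l (ltW K0) (cell_near _ _ cc)).
    exact: ler_wpM2r.
  move: aj; rewrite a_diff normrM (gtr0_norm lN0) mulrC -ler_pdivlMr // => /le_trans; apply.
  rewrite invf_div [X in X <= _](_ : _ = l^-1 * (K%:R * N%:R)); last first.
    by field; rewrite !gt_eqF.
  rewrite natrM natrX expr2 -mulrA; by apply: ler_wpM2r => //; rewrite -?natrM ler0n.
have coord_itv (m : grid) j : (ref m j <= m j + K ^ 2 * N)%N /\ (m j <= ref m j + K ^ 2 * N)%N.
  have := coord_near (ref m) m j (esym (ref_cell m)).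
  rewrite ler_norml => /andP[l1 l2].
  by split; rewrite -(ler_nat R) natrD; lra.
have coord_win (m : grid) j : (m j + K ^ 2 * N - ref m j < W.+1)%N.
  by have [] := coord_itv m j; rewrite WE; lia.
(* In a given cell, a grid point is determined by n of its coordinates, close to
   those of the reference point, and by the residue of the remaining one: the
   linear form v, with coefficient 1 there, confines this coordinate to a window
   of bounded size once the others are known. *)
pose window (m : grid) : {ffun 'I_n -> 'I_W.+1} :=
  [ffun k => Ordinal (coord_win m (lift (idx (ref m)) k))].
pose residue (m : grid) : 'I_B.+1 := inord (m (idx (ref m)) %% B.+1).
pose code (m : grid) := (cell m, window m, residue m).
suff code_inj : injective code.
  have := leq_card code code_inj.
  by rewrite !card_prod !card_ffun !card_ord.
move=> m m' E; have cc : cell m = cell m' := congr1 (fun x => x.1.1) E.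
have ww : window m = window m' := congr1 (fun x => x.1.2) E.
have rr : residue m = residue m' := congr1 snd E.
clear E code.
have rm := ref_eq _ _ cc; have [i iE] : exists i, idx (ref m) = i by eexists.
have off k : k != i -> m k = m' k.
  case: (unliftP i k) => [h -> _|->]; last by rewrite eqxx.
  have := congr1 (fun f : {ffun 'I_n -> 'I_W.+1} => nat_of_ord (f h)) ww.
  rewrite /window !ffunE /= -rm iE; have [l1 _] := coord_itv m (lift i h).
  have [l2 _] := coord_itv m' (lift i h); rewrite -rm in l2.
  by move=> E; apply: val_inj => /=; lia.
apply/ffunP => k; have [->|/off //] := eqVneq k i.
have m1 := flat_near (ref m) m (esym (ref_cell m)).
have m2 := flat_near (ref m) m' _; rewrite ref_cell in m2.
have {m2} := m2 (esym cc).
have dist : \sum_j vf (ref m) 0 j * ((m j)%:R - (ref m j)%:R) -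
    \sum_j vf (ref m) 0 j * ((m' j)%:R - (ref m j)%:R) = (m i)%:R - (m' i)%:R :> R.
  rewrite -sumrB (bigD1 i) // big1 => [|j ji]; last by rewrite (congr1 _ (off _ ji)) subrr.
  by have := v_idx (ref m); rewrite iE /= => ->; ring.
move=> m2; have : `|(m i)%:R - (m' i)%:R| <= B%:R :> R.
  rewrite -dist BE natrM natrX mulr_natl mulr2n.
  by apply: le_trans (ler_normB _ _) _; exact: lerD.
rewrite ler_norml => /andP[l1 l2]; apply: val_inj; apply: (@modn_close B).
- by rewrite -(ler_nat R) natrD; lra.
- by rewrite -(ler_nat R) natrD; lra.
- have := congr1 (@nat_of_ord _) rr; by rewrite /residue -rm iE !inordK // ltn_pmod.
Qed.

End Counting.

(** * Uniform Taylor estimates *)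

Section TaylorEstimates.
Context {R : realType}.

Lemma le_norm_mx m n (A : 'M[R]_(m, n)) i j : `|A i j| <= `|A|.
Proof.
by rewrite [leRHS]mx_normrE; apply: (le_bigmax _ (fun i => `|A i.1 i.2|) (i, j)).
Qed.

Lemma cube_convex n (y x x' : 'rV[R]_n) r t : 0 <= t <= 1 ->
  cube y r x -> cube y r x' -> cube y r (x + t *: (x' - x)).
Proof.
move=> /andP[t0 t1]; rewrite /cube /= => xy xy'.
have -> : x + t *: (x' - x) - y = (1 - t) *: (x - y) + t *: (x' - y).
  by apply/rowP => i; rewrite !mxE; ring.
rewrite (le_trans (ler_normD _ _)) // !normrZ (ger0_norm t0) ger0_norm ?subr_ge0 //.
have h1 : (1 - t) * `|x - y| <= (1 - t) * r by rewrite ler_wpM2l // subr_ge0.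
have h2 : t * `|x' - y| <= t * r by rewrite ler_wpM2l.
lra.
Qed.

Lemma mean_value n (y0 x y : 'rV[R]_n) r (g : 'rV[R]_n -> R) :
  (forall z, cube y0 r z -> differentiable g z) -> cube y0 r x -> cube y0 r y ->
  exists z, [/\ cube y0 r z, `|z - x| <= `|y - x| &
                g y - g x = \sum_i (y - x) 0 i * pd i g z].
Proof.
move=> dg xK yK.
pose p (t : R) : 'rV[R]_n := x + t *: (y - x).
have dp (t : R) : is_derive t 1 p (y - x).
  have dl : is_derive t 1 ( *:%R^~ (y - x) : R -> 'rV[R]_n) (y - x).
    have [dZ EZ] := @is_diff_scalel R _ t (y - x).
    split; first exact/derivable1_diffP.
    by rewrite deriveE // EZ scale1r.
  have := is_deriveD (is_derive_cst x t 1) dl.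
  by rewrite add0r.
have pK (t : R) : t \in `[0, 1] -> cube y0 r (p t).
  by rewrite in_itv /= => t01; exact: cube_convex.
have dgp (t : R) : t \in `[0, 1] -> is_derive t 1 (g \o p) ('D_(y - x) g (p t)).
  move=> tI; have dgt := dg _ (pK _ tI).
  have dpt : differentiable p t by apply/derivable1_diffP; case: (dp t).
  split; first by apply/derivable1_diffP; exact: differentiable_comp.
  rewrite deriveE; last exact: differentiable_comp.
  rewrite diff_comp //= deriveE //; congr ('d g _ _).
  by rewrite -deriveE //; case: (dp t).
have dgpo (t : R) : t \in `]0, 1[ -> is_derive t 1 (g \o p) ('D_(y - x) g (p t)).
  by move=> tI; apply: dgp; apply: subset_itv_oo_cc tI.
have cgp : {within `[0, 1], continuous (g \o p)}.
  apply: derivable_within_continuous => t tI.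
  by case: (dgp t tI).
have [t tI] := MVT_segment ler01 dgpo cgp.
rewrite /= /p scale1r scale0r addr0 subr0 mulr1 [x + (y - x)]addrC subrK -/(p t) => E.
exists (p t); split; [exact: pK| |by rewrite E derive_pd //; exact/dg/pK].
rewrite /p [x + _]addrC addrK normrZ; move: tI; rewrite in_itv /= => /andP[t0 t1].
by rewrite ger0_norm // ler_piMl.
Qed.

Lemma lipschitz_cube n (y0 x y : 'rV[R]_n) r (g : 'rV[R]_n -> R) L :
  (forall z, cube y0 r z -> differentiable g z) ->
  (forall z i, cube y0 r z -> `|pd i g z| <= L) ->
  cube y0 r x -> cube y0 r y -> `|g y - g x| <= n%:R * L * `|y - x|.
Proof.
move=> dg gL xK yK; have [z [zK _ ->]] := mean_value dg xK yK.
rewrite (le_trans (ler_norm_sum _ _ _)) //.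
apply: (@le_trans _ _ (\sum_(i < n) L * `|y - x|)).
  apply: ler_sum => i _; rewrite normrM mulrC ler_pM //; first exact: gL.
  exact: le_norm_mx.
by rewrite sumr_const card_ord -[leLHS]mulr_natl mulrA.
Qed.

Lemma taylor_cube n (y0 x y : 'rV[R]_n) r (g : 'rV[R]_n -> R) L :
  (forall z, cube y0 r z -> differentiable g z) ->
  (forall z i, cube y0 r z -> differentiable (pd i g) z) ->
  (forall z i j, cube y0 r z -> `|pd j (pd i g) z| <= L) -> 
  cube y0 r x -> cube y0 r y ->
  `|g y - g x - \sum_i (y - x) 0 i * pd i g x| <= n%:R ^+ 2 * L * `|y - x| ^+ 2.
Proof.
move=> dg ddg gL xK yK; have [z [zK zx ->]] := mean_value dg xK yK.
have [n0|n0] := posnP n.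
  subst n; rewrite !big_ord0 subrr normr0.
  by rewrite expr0n /= mul0r mul0r.
have L0 : 0 <= L by exact: le_trans (normr_ge0 _) (gL x (Ordinal n0) (Ordinal n0) xK).
rewrite -sumrB (le_trans (ler_norm_sum _ _ _)) //.
apply: (@le_trans _ _ (\sum_(i < n) (`|y - x| * (n%:R * L * `|y - x|)))).
  apply: ler_sum => i _; rewrite -mulrBr normrM ler_pM //; first exact: le_norm_mx.
  apply: (@le_trans _ _ (n%:R * L * `|z - x|)).
    apply: (@lipschitz_cube _ y0 _ _ r) => //.
    - by move=> w; exact: ddg.
    - by move=> w j; exact: gL.
  by rewrite ler_wpM2l // mulr_ge0.
rewrite sumr_const card_ord -[leLHS]mulr_natl.
suff -> : n%:R * (`|y - x| * (n%:R * L * `|y - x|)) = n%:R ^+ 2 * L * `|y - x| ^+ 2 by [].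
by ring.
Qed.

Lemma bounded_cube n (y0 : 'rV[R]_n) r (g : 'rV[R]_n -> R) : 0 < r ->
  (forall z, cube y0 r z -> differentiable g z) ->
  exists2 L, 0 <= L & forall z, cube y0 r z -> `|g z| <= L.
Proof.
move=> r0 dg.
have cg : {within cube y0 r, continuous (fun z => `|g z|)}.
  apply: continuous_in_subspaceT => z /set_mem zK.
  have cz : g @ z --> g z by exact: differentiable_continuous (dg _ zK).
  exact: cvg_norm cz.
have K0 : cube y0 r !=set0 by exists y0; rewrite /cube /= subrr normr0 ltW.
have [z zK zmax] := compact_EVT_max K0 (@compact_cube R n y0 r r0) cg.
exists `|g z| => // w wK; apply: zmax; exact/mem_set.
Qed.

Lemma ex2_and (T : Type) (P Q : T -> Prop) :
  (exists2 x, P x & Q x) -> exists x, P x /\ Q x.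
Proof. by case=> x Px Qx; exists x. Qed.

(** The derivatives of order at most two are bounded on the compact cube; the sum
    of their bounds over the finite family serves all its members. *)
Lemma smooth_estimates n (U : set 'rV[R]_n) (y0 : 'rV[R]_n) r (I : finType)
    (g : I -> 'rV[R]_n -> R) : 0 < r -> cube y0 r `<=` U ->
  (forall i, smooth_on U (g i)) ->
  exists2 L, 0 <= L & forall i x y, cube y0 r x -> cube y0 r y ->
    `|g i y - g i x| <= L * `|y - x| /\
    `|g i y - g i x - \sum_j (y - x) 0 j * pd j (g i) x| <= L * `|y - x| ^+ 2.
Proof.
move=> r0 KU sg.
have d0 i z : cube y0 r z -> differentiable (g i) z.
  by move=> /KU; exact: smooth_on_differentiable (sg i).
have d1 i j z : cube y0 r z -> differentiable (pd j (g i)) z.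
  by move=> /KU; exact: smooth_on_differentiable (smooth_on_pd j (sg i)).
have d2 i j h z : cube y0 r z -> differentiable (pd h (pd j (g i))) z.
  by move=> /KU; exact: smooth_on_differentiable (smooth_on_pd h (smooth_on_pd j (sg i))).
have [L1 L1P] := choice (fun ij : I * 'I_n => ex2_and (bounded_cube r0 (d1 ij.1 ij.2))).
have [L2 L2P] := choice (fun ij : I * 'I_n * 'I_n =>
  ex2_and (bounded_cube r0 (d2 ij.1.1 ij.1.2 ij.2))).
pose L : R := \sum_ij L1 ij + \sum_ij L2 ij.
have s1 : 0 <= \sum_ij L1 ij by apply: sumr_ge0 => ij _; case: (L1P ij).
have s2 : 0 <= \sum_ij L2 ij by apply: sumr_ge0 => ij _; case: (L2P ij).
have le_L1 ij : L1 ij <= L.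
  rewrite /L (bigD1 ij) //= -addrA lerDl addr_ge0 //.
  by apply: sumr_ge0 => ij' _; case: (L1P ij').
have le_L2 ij : L2 ij <= L.
  rewrite /L [X in _ + X](bigD1 ij) //= addrCA lerDl addr_ge0 //.
  by apply: sumr_ge0 => ij' _; case: (L2P ij').
have L0 : 0 <= L by exact: addr_ge0.
have nat2 : n%:R <= n%:R ^+ 2 + 1 :> R by rewrite -natrX natr1 ler_nat; nia.
have nat1 : 0 <= n%:R :> R by [].
exists ((n%:R ^+ 2 + 1) * L); first by rewrite mulr_ge0 // addr_ge0 // exprn_ge0.
move=> i x y xK yK; split.
  apply: le_trans (lipschitz_cube (d0 i) (L := L) _ xK yK) _.
    move=> z j zK; apply: le_trans (le_L1 (i, j)).
    by have [_ ] := L1P (i, j); exact.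
  by apply: ler_wpM2r => //; exact: ler_wpM2r.
apply: le_trans (taylor_cube (d0 i) (fun z j => @d1 i j z) (L := L) _ xK yK) _.
  move=> z j h zK; apply: le_trans (le_L2 (i, j, h)).
  by have [_ ] := L2P (i, j, h); exact.
apply: ler_wpM2r; first exact: exprn_ge0.
by apply: ler_wpM2r => //; rewrite lerDl.
Qed.

End TaylorEstimates.

(** * Generic covectors *)

Section GenericCovector.
Context {R : realType}.

Lemma norm_mulmx m n p (A : 'M[R]_(m, n)) (B : 'M[R]_(n, p)) :
  `|A *m B| <= n%:R * `|A| * `|B|.
Proof.
rewrite [X in X <= _]mx_normrE; apply: bigmax_le => [|[i j] _ /=].
  by rewrite !mulr_ge0.
rewrite mxE (le_trans (ler_norm_sum _ _ _)) //.
apply: (@le_trans _ _ (\sum_(k < n) `|A| * `|B|)).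
  by apply: ler_sum => k _; rewrite normrM ler_pM // le_norm_mx.
by rewrite sumr_const card_ord -[leLHS]mulr_natl mulrA.
Qed.

Lemma norm_trmx m n (A : 'M[R]_(m, n)) : `|A^T| = `|A|.
Proof.
suff le p q (B : 'M[R]_(p, q)) : `|B^T| <= `|B|.
  by apply/eqP; rewrite eq_le le //= -{1}[A]trmxK le.
rewrite [X in X <= _]mx_normrE; apply: bigmax_le => // -[i j] _ /=.
by rewrite mxE le_norm_mx.
Qed.

Lemma norm_le_mx m n (A : 'M[R]_(m, n)) e :
  0 <= e -> (forall i j, `|A i j| <= e) -> `|A| <= e.
Proof. by move=> e0 Ae; rewrite [X in X <= _]mx_normrE; apply: bigmax_le => // -[i j] _ /=. Qed.

(** An idempotent is conjugate to a diagonal, hence symmetric, idempotent. *)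
Lemma idempotent_conj_sym n (P : 'M[R]_n) : P *m P = P ->
  exists D E : 'M[R]_n, [/\ D \in unitmx, P = invmx D *m E *m D,
    E *m E = E & E^T = E].
Proof.
case: n P => [|n] P PP.
  by exists 1%:M, 1%:M; split; rewrite ?unitmx1 ?mulmx1 ?trmx1 //; apply/matrixP => -[].
have /diagonalizableP [D Du] : exists2 rs, uniq rs & mxminpoly P %| \prod_(x <- rs) ('X - x%:P).
  exists [:: 0; 1]; first by rewrite /= inE eq_sym oner_eq0.
  apply: mxminpoly_min; rewrite !big_cons big_nil mulr1 rmorphM /= !rmorphB /=.
  by rewrite horner_mx_X !horner_mx_C rmorph0 rmorph1 subr0 mulrBr mulr1 [P * P]PP subrr.
move=> /(diagonalizable_forLR Du) [d PE0].
have PE : P = invmx D *m diag_mx d *m D := eq_trans PE0 (conjVmx _ Du).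
exists D, (diag_mx d); split=> //; last exact: tr_diag_mx.
have EE : D *m P *m invmx D = diag_mx d.
  by rewrite PE !mulmxA mulmxV // mul1mx mulmxK.
by rewrite -EE !mulmxA mulmxKV // -[D *m P *m P]mulmxA PP.
Qed.

Definition combination n (F0 : 'rV[R]_n -> R) (C : 'rV[R]_n -> 'rV[R]_n)
  (a : 'rV[R]_n) : 'rV[R]_n -> R := fun x => F0 x + \sum_i a 0 i * C x 0 i.

Lemma pderiv_combination n (U : set 'rV[R]_n) F0 C a s x : open U ->
  smooth_on U F0 -> vsmooth_on U C -> U x ->
  pderiv s (combination F0 C a) x =
  pderiv s F0 x + \sum_i a 0 i * pderiv s (fun y => C y 0 i) x.
Proof.
move=> oU sF sC Ux.
have sau i : smooth_on U (fun x => a 0 i * C x 0 i).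
  by apply/smooth_closureP => //; apply/sc_scale/sc_base; exact: sC.
rewrite -[LHS]/(pderiv s (F0 \+ (fun x => \sum_i a 0 i * C x 0 i)) x).
rewrite (pderivD _ oU sF _ Ux); last first.
  by apply/smooth_closureP => //; apply: sc_sum => i; exact: sc_base.
congr (_ + _); rewrite (pderiv_sum _ _ oU sau Ux).
by apply: eq_bigr => i _; rewrite (pderiv_scale _ _ oU (sC i) Ux).
Qed.

Section Estimates.
Variables (n : nat) (U : set 'rV[R]_n) (y0 : 'rV[R]_n) (r : R).
Variables (F0 : 'rV[R]_n -> R) (C : 'rV[R]_n -> 'rV[R]_n) (Fix : set 'rV[R]_n).
Hypotheses (r0 : 0 < r) (oU : open U) (KU : cube y0 r `<=` U).
Hypotheses (sF : smooth_on U F0) (sC : vsmooth_on U C).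
Hypothesis FixP : forall q, Fix q -> cube y0 r q /\ C q = q.
Let P := jacm C y0.
Hypothesis jac_near : forall x, cube y0 r x -> n%:R * `|jacm C x - P| <= 1 / 2.
Let N : R := n%:R.
Let Fa := combination F0 C.

Let C_mean q q' j : cube y0 r q -> cube y0 r q' ->
  exists2 z, cube y0 r z & (C q' - C q) 0 j = ((q' - q) *m jacm C z) 0 j.
Proof.
move=> qK q'K.
have dCj z : cube y0 r z -> differentiable (fun y => C y 0 j) z.
  by move=> /KU; exact: smooth_on_differentiable (sC j).
have [z [zK _ E]] := mean_value dCj qK q'K.
exists z => //; rewrite [LHS]mxE [X in _ + X]mxE E [RHS]mxE.
by apply: eq_bigr => i _; rewrite [jacm _ _ _ _]mxE.
Qed.

(** On the fixed set C is the identity, whereas its differential is close to P: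
    the fixed set projects injectively to the image of P, with a Lipschitz
    inverse. *)
Lemma fix_tangent q q' : Fix q -> Fix q' -> `|q' - q| <= 2 * `|(q' - q) *m P|.
Proof.
move=> /FixP[qK Cq] /FixP[q'K Cq'].
suff : `|q' - q - (q' - q) *m P| <= 1 / 2 * `|q' - q|.
  move=> h; have := ler_normD (q' - q - (q' - q) *m P) ((q' - q) *m P).
  rewrite subrK; lra.
apply: norm_le_mx => [|i j]; first by rewrite mulr_ge0.
rewrite ord1; have [z zK E] := C_mean j qK q'K.
rewrite Cq Cq' in E; rewrite !mxE in E *; rewrite E.
have := norm_mulmx (q' - q) (jacm C z - P).
move=> /(le_trans (le_norm_mx _ 0 j)) h.
have -> : \sum_k (q' - q) 0 k * jacm C z k j - \sum_k (q' - q) 0 k * P k j =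
    ((q' - q) *m (jacm C z - P)) 0 j.
  by rewrite mulmxBr !mxE.
apply: le_trans h _; rewrite -/N mulrAC; apply: ler_wpM2r => //.
exact: jac_near.
Qed.

(** A bounded set of covectors is used, so that L does not depend on a. *)
Lemma gradient_estimates : exists2 L, 0 <= L &
  forall a q q', `|a| <= 1 -> cube y0 r q -> cube y0 r q' ->
  [/\ `|grad (Fa a) q' - grad (Fa a) q| <= L * `|q' - q|,
      `|grad (Fa a) q' - grad (Fa a) q - (q' - q) *m hessm (Fa a) q|
        <= L * `|q' - q| ^+ 2 &
      `|jacm C q' - jacm C q| <= L * `|q' - q|].
Proof.
have [L1 L10 L1P] := smooth_estimates r0 KU (fun j : 'I_n => smooth_on_pd j sF).
have [L2 L20 L2P] := smooth_estimates r0 KU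
  (fun ji : 'I_n * 'I_n => smooth_on_pd ji.1 (sC ji.2)).
have N0 : 0 <= N by [].
exists (L1 + (N + 1) * L2); first by rewrite addr_ge0 // mulr_ge0 // addr_ge0.
move=> a q q' a1 qK q'K; set d := `|q' - q|.
have d0 : 0 <= d by exact: normr_ge0.
have pd1 j x : cube y0 r x -> pd j (Fa a) x = pd j F0 x + \sum_i a 0 i * pd j (fun y => C y 0 i) x.
  by move=> /KU Ux; exact: (pderiv_combination a [:: j] oU sF sC Ux).
have pd2 h j x : cube y0 r x -> pd h (pd j (Fa a)) x =
    pd h (pd j F0) x + \sum_i a 0 i * pd h (pd j (fun y => C y 0 i)) x.
  by move=> /KU Ux; exact: (pderiv_combination a [:: h; j] oU sF sC Ux).
have sum_a e (u : 'I_n -> R) : (forall i, `|u i| <= e) -> `|\sum_i a 0 i * u i| <= N * e.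
  move=> ue; rewrite (le_trans (ler_norm_sum _ _ _)) //.
  apply: (@le_trans _ _ (\sum_(i < n) 1 * e)); last first.
    by rewrite sumr_const card_ord -[leLHS]mulr_natl mul1r.
  apply: ler_sum => i _; rewrite normrM ler_pM //.
  exact: le_trans (le_norm_mx a 0 i) a1.
split.
- apply: norm_le_mx => [|i j]; first by rewrite mulr_ge0 // addr_ge0 // mulr_ge0 // addr_ge0.
  rewrite !mxE !pd1 //.
  have h1 := (L1P j q q' qK q'K).1.
  have := sum_a (L2 * d) (fun i => pd j (fun y => C y 0 i) q' - pd j (fun y => C y 0 i) q) _.
  move=> /(_ (fun i => (L2P (j, i) q q' qK q'K).1)) h2.
  have -> : forall a b c e : R, a + b - (c + e) = (a - c) + (b - e) by move=> *; ring.
  rewrite -sumrB; under eq_bigr do rewrite -mulrBr.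
  apply: le_trans (ler_normD _ _) _; apply: le_trans (lerD h1 h2) _.
  rewrite -/d; have := mulr_ge0 L20 d0; lra.
- apply: norm_le_mx => [|i j]; first by rewrite mulr_ge0 ?exprn_ge0 // addr_ge0 // mulr_ge0 // addr_ge0.
  have -> : (grad (Fa a) q' - grad (Fa a) q - (q' - q) *m hessm (Fa a) q) i j =
    (pd j F0 q' - pd j F0 q - \sum_h (q' - q) 0 h * pd h (pd j F0) q) +
    \sum_i a 0 i * (pd j (fun y => C y 0 i) q' - pd j (fun y => C y 0 i) q -
      \sum_h (q' - q) 0 h * pd h (pd j (fun y => C y 0 i)) q).
    rewrite ord1 !mxE !pd1 //.
    under [X in _ - X = _]eq_bigr do rewrite [hessm _ _ _ _]mxE pd2 // mulrDr mulr_sumr.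
    under [X in _ = _ + X]eq_bigr do rewrite !mulrBr mulr_sumr.
    rewrite big_split /= !sumrB [X in _ - (_ + X) = _]exchange_big /=.
    under [X in _ - (_ + X) = _]eq_bigr do under eq_bigr do rewrite mulrCA.
    ring.
  have h1 := (L1P j q q' qK q'K).2.
  have := sum_a (L2 * d ^+ 2) _ (fun i => (L2P (j, i) q q' qK q'K).2) => h2.
  apply: le_trans (ler_normD _ _) _; apply: le_trans (lerD h1 h2) _.
  rewrite -/d; have := mulr_ge0 L20 (exprn_ge0 2 d0); lra.
- apply: norm_le_mx => [|j i]; first by rewrite mulr_ge0 // addr_ge0 // mulr_ge0 // addr_ge0.
  rewrite !mxE; apply: le_trans (L2P (j, i) q q' qK q'K).1 _.
  apply: ler_wpM2r => //; rewrite mulrDl mul1r.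
  by have := mulr_ge0 N0 L20; lra.
Qed.

End Estimates.

Lemma pd_combination n (U : set 'rV[R]_n) F0 C a j x : open U ->
  smooth_on U F0 -> vsmooth_on U C -> U x ->
  pd j (combination F0 C a) x =
  pd j F0 x + \sum_i a 0 i * pd j (fun y => C y 0 i) x.
Proof. by move=> oU sF sC Ux; exact: (pderiv_combination a [:: j] oU sF sC Ux). Qed.

Lemma grad_combination n (U : set 'rV[R]_n) F0 C a x : open U ->
  smooth_on U F0 -> vsmooth_on U C -> U x ->
  grad (combination F0 C a) x = grad F0 x + a *m (jacm C x)^T.
Proof.
move=> oU sF sC Ux; apply/rowP => j; rewrite !mxE (pd_combination _ _ oU sF sC Ux).
by congr (_ + _); apply: eq_bigr => i _; rewrite !mxE.
Qed.

Lemma exists_unit_entry n (v : 'rV[R]_n) : v != 0 ->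
  exists b i, (b *: v) 0 i = 1 /\ `|b *: v| <= 1.
Proof.
move=> v0; have nv0 : mx_norm v != 0 by rewrite -[mx_norm v]/(`|v|) normr_eq0.
have [[j i] /= vi] := mx_norm_neq0 nv0.
rewrite ord1 in vi; have nv : `|v| = `|v 0 i| := vi.
have vi0 : v 0 i != 0 by rewrite -normr_eq0 -nv normr_eq0.
exists (v 0 i)^-1, i; split; first by rewrite mxE mulVf.
by rewrite normrZ normfV nv mulVf // normr_eq0.
Qed.

(** Generic covectors make the critical points on the fixed set nondegenerate
    along the fixed set.  A pair of a point q and a covector a for which this
    fails is determined by d coordinates of q and n - d coordinates of a, where
    d is the dimension of the fixed set, because criticality at q prescribes the
    restriction of a to the image of P; these n coordinates are gathered in z.
    When z moves by h, the covector a moves by O(h), and by O(h^2) in the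
    direction of a null vector of the Hessian. *)
Lemma generic_covector n (U : set 'rV[R]_n) (y0 : 'rV[R]_n) (r l : R)
    (F0 : 'rV[R]_n -> R) (C : 'rV[R]_n -> 'rV[R]_n) (Fix : set 'rV[R]_n) :
  0 < r -> 0 < l -> open U -> cube y0 r `<=` U ->
  smooth_on U F0 -> vsmooth_on U C ->
  (forall q, Fix q -> cube y0 r q /\ C q = q) ->
  jacm C y0 *m jacm C y0 = jacm C y0 ->
  (forall x, cube y0 r x -> n%:R * `|jacm C x - jacm C y0| <= 1 / 2) ->
  exists2 a, `|a| <= l & forall q, Fix q -> grad (combination F0 C a) q = 0 ->
    forall v : 'rV[R]_n, v *m jacm C q = v ->
      hessm (combination F0 C a) q *m v^T = 0 -> v = 0.
Proof.
move=> r0 l0 oU KU sF sC FixP PP jac_near; set P := jacm C y0 in PP jac_near.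
pose Fa := combination F0 C.
have [D [E [Du PE EE ET]]] := idempotent_conj_sym PP.
have [L L0 est] := gradient_estimates r0 oU KU sF sC.
have FixK q : Fix q -> cube y0 r q by move=> /FixP[].
pose N : R := n%:R; have N0 : 0 <= N by [].
(* In the bases given by D, z records q *m P and a *m (1 - P^T), see qP and aP
   below. *)
pose zmap (q a : 'rV[R]_n) := q *m (invmx D *m E) + a *m (D^T *m (1%:M - E)).
(* The covectors to avoid, with a critical point q and a null vector v of the
   Hessian along the fixed set that witness it.  The normalization of v keeps
   the estimates uniform. *)
pose Rel (z a : 'rV[R]_n) := exists q v : 'rV[R]_n, exists i,
  [/\ `|a| <= 1, Fix q, grad (Fa a) q = 0 & z = zmap q a] /\
  [/\ v *m jacm C q = v, hessm (Fa a) q *m v^T = 0, v 0 i = 1 & `|v| <= 1].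
have E2 : E *m (1%:M - E) = 0 by rewrite mulmxBr mulmx1 EE subrr.
have E3 : (1%:M - E) *m E = 0 by rewrite mulmxBl mul1mx EE subrr.
have E1 : (1%:M - E) *m (1%:M - E) = 1%:M - E.
  by rewrite mulmxBl mul1mx E2 subr0.
have zE q a : zmap q a *m E = q *m (invmx D *m E).
  by rewrite /zmap mulmxDl -!mulmxA EE E3 !mulmx0 addr0.
have zE' q a : zmap q a *m (1%:M - E) = a *m (D^T *m (1%:M - E)).
  by rewrite /zmap mulmxDl -!mulmxA E2 E1 !mulmx0 add0r.
have PT : 1%:M - P^T = D^T *m (1%:M - E) *m invmx D^T.
  rewrite PE !trmx_mul ET trmx_inv mulmxBr mulmx1 mulmxBl mulmxV ?unitmx_tr //.
  by rewrite !mulmxA.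
have zB q a q' a' : zmap q' a' - zmap q a = zmap (q' - q) (a' - a).
  rewrite /zmap !mulmxBl; set A1 := q' *m _; set A2 := q *m _.
  by rewrite opprD addrACA.
have qP q a : q *m P = zmap q a *m E *m D.
  by rewrite zE PE !mulmxA.
have aP q a : a *m (1%:M - P^T) = zmap q a *m (1%:M - E) *m invmx D^T.
  by rewrite zE' PT !mulmxA.
pose c1 := 2 * (N * `|E *m D|).
pose c2 := 2 * (L * c1 + N * `|(1%:M - E) *m invmx D^T|).
have c10 : 0 <= c1 by rewrite !mulr_ge0.
have c20 : 0 <= c2 by rewrite mulr_ge0 // addr_ge0 // mulr_ge0.
have q_lip z a z' a' q q' : Fix q -> Fix q' -> z = zmap q a -> z' = zmap q' a' ->
    `|q' - q| <= c1 * `|z' - z|.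
  move=> Fq Fq' -> ->.
  apply: le_trans (fix_tangent KU sC FixP jac_near Fq Fq') _.
  rewrite (qP _ (a' - a)) -zB -mulmxA /c1 -!mulrA; apply: ler_wpM2l => //.
  apply: le_trans (norm_mulmx _ _) _.
  by rewrite -/N -mulrA; apply: ler_wpM2l => //; rewrite mulrC.
clearbody c1.
have grad_diff a a' q q' : Fix q -> Fix q' -> grad (Fa a) q = 0 -> grad (Fa a') q' = 0 ->
    (a' - a) *m (jacm C q')^T = - (grad (Fa a) q' - grad (Fa a) q).
  move=> Fq Fq' g0; rewrite g0 subr0.
  rewrite !(grad_combination _ oU sF sC (KU _ (FixK _ Fq'))) mulmxBl => g0'.
  by rewrite opprD -[- grad F0 q']addr0 -g0' addrCA addrA subrr add0r addrC.
(* The part of a' - a in the image of P^T is given by the difference of the two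
   critical equations, and the complementary part is read on z. *)
have a_lip z a z' a' q q' : `|a| <= 1 -> Fix q -> Fix q' -> z = zmap q a -> z' = zmap q' a' ->
    grad (Fa a) q = 0 -> grad (Fa a') q' = 0 -> `|a' - a| <= c2 * `|z' - z|.
  move=> a1 Fq Fq' zq zq' g0 g0'.
  have qz := q_lip _ _ _ _ _ _ Fq Fq' zq zq'.
  have [e1 _ _] := est a q q' a1 (FixK _ Fq) (FixK _ Fq').
  have aA : `|(a' - a) *m (jacm C q')^T| <= L * (c1 * `|z' - z|).
    rewrite (grad_diff a a' q q') // normrN; apply: le_trans e1 _.
    exact: ler_wpM2l.
  have aAP : `|(a' - a) *m (jacm C q' - P)^T| <= 1 / 2 * `|a' - a|.
    apply: le_trans (norm_mulmx _ _) _; rewrite norm_trmx mulrAC.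
    by apply: ler_wpM2r => //; exact/jac_near/FixK.
  have aQ : `|(a' - a) *m (1%:M - P^T)| <= N * `|(1%:M - E) *m invmx D^T| * `|z' - z|.
    rewrite (aP (q' - q)) -zB -zq -zq' -mulmxA.
    by apply: le_trans (norm_mulmx _ _) _; rewrite -/N mulrAC.
  have dec : a' - a = (a' - a) *m (jacm C q')^T - (a' - a) *m (jacm C q' - P)^T
                      + (a' - a) *m (1%:M - P^T).
    rewrite linearB /= !mulmxBr mulmx1 opprB [X in _ = X + _]addrC subrK.
    by rewrite [RHS]addrC subrK.
  have := ler_normD ((a' - a) *m (jacm C q')^T - (a' - a) *m (jacm C q' - P)^T)
    ((a' - a) *m (1%:M - P^T)).
  rewrite -dec.
  have := ler_normB ((a' - a) *m (jacm C q')^T) ((a' - a) *m (jacm C q' - P)^T).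
  rewrite /c2; lra.
clearbody c2.
pose c3 := N * L * c1 ^+ 2 + N ^+ 2 * (c2 * (L * c1)).
have c30 : 0 <= c3.
  apply: addr_ge0; first by apply: mulr_ge0; [exact: mulr_ge0|exact: exprn_ge0].
  apply: mulr_ge0; first exact: exprn_ge0.
  by apply: mulr_ge0 => //; exact: mulr_ge0.
(* Pair the difference of the two critical equations with v: the first order
   term of the gradient disappears since the Hessian kills v. *)
have v_flat z a z' a' q q' (v : 'rV[R]_n) : `|a| <= 1 -> Fix q -> Fix q' ->
    z = zmap q a -> z' = zmap q' a' -> grad (Fa a) q = 0 -> grad (Fa a') q' = 0 ->
    v *m jacm C q = v -> hessm (Fa a) q *m v^T = 0 -> `|v| <= 1 ->
    `|\sum_j v 0 j * (a' - a) 0 j| <= c3 * `|z' - z| ^+ 2.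
  move=> a1 Fq Fq' zq zq' g0 g0' vA vH v1.
  have qz := q_lip _ _ _ _ _ _ Fq Fq' zq zq'.
  have az := a_lip _ _ _ _ _ _ a1 Fq Fq' zq zq' g0 g0'.
  have [_ e2 e3] := est a q q' a1 (FixK _ Fq) (FixK _ Fq').
  have vE : \sum_j v 0 j * (a' - a) 0 j = ((a' - a) *m v^T) 0 0.
    by rewrite [RHS]mxE; apply: eq_bigr => j _; rewrite [v^T _ _]mxE mulrC.
  have vA' : (jacm C q)^T *m v^T = v^T by rewrite -trmx_mul vA.
  pose T1 := grad (Fa a) q' - grad (Fa a) q - (q' - q) *m hessm (Fa a) q.
  have dec : (a' - a) *m v^T = - (T1 *m v^T) - (a' - a) *m (jacm C q' - jacm C q)^T *m v^T.
    have -> : T1 *m v^T = (grad (Fa a) q' - grad (Fa a) q) *m v^T.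
      by rewrite /T1 [LHS]mulmxBl -mulmxA vH mulmx0 subr0.
    rewrite -mulNmx -(grad_diff a a' q q') // -mulmxBl linearB /= [X in _ = (_ - X) *m _]mulmxBr opprB.
    by rewrite [X in _ = X *m _]addrC subrK -mulmxA vA'.
  rewrite vE dec.
  have t1 : `|T1 *m v^T| <= N * L * c1 ^+ 2 * `|z' - z| ^+ 2.
    apply: le_trans (norm_mulmx _ _) _; rewrite norm_trmx -/N.
    apply: (@le_trans _ _ (N * (L * `|q' - q| ^+ 2) * 1)).
      by apply: ler_pM => //; [rewrite mulr_ge0 | exact: ler_wpM2l].
    have qz2 : `|q' - q| ^+ 2 <= c1 ^+ 2 * `|z' - z| ^+ 2.
      by rewrite -exprMn; apply: lerXn2r; rewrite ?nnegrE ?mulr_ge0.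
    rewrite mulr1; apply: le_trans (ler_wpM2l N0 (ler_wpM2l L0 qz2)) _.
    by rewrite !mulrA.
  have t2 : `|(a' - a) *m (jacm C q' - jacm C q)^T *m v^T| <=
      N ^+ 2 * (c2 * (L * c1)) * `|z' - z| ^+ 2.
    apply: le_trans (norm_mulmx _ _) _; rewrite norm_trmx -/N.
    apply: (@le_trans _ _ (N * `|(a' - a) *m (jacm C q' - jacm C q)^T| * 1)).
      by apply: ler_wpM2l => //; rewrite mulr_ge0.
    rewrite mulr1 expr2 -!mulrA; apply: ler_wpM2l => //.
    apply: le_trans (norm_mulmx _ _) _; rewrite norm_trmx -/N -mulrA.
    apply: ler_wpM2l => //.
    apply: (@le_trans _ _ ((c2 * `|z' - z|) * (L * (c1 * `|z' - z|)))).
      apply: ler_pM => //; apply: le_trans e3 _; exact: ler_wpM2l.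
    by rewrite le_eqVlt; apply/orP; left; apply/eqP; ring.
  apply: le_trans (le_norm_mx _ 0 0) _; apply: le_trans (ler_normB _ _) _.
  by rewrite normrN /c3 mulrDl; exact: lerD.
clearbody c3.
pose c4 := N * (`|y0| + r) * `|invmx D *m E| + N * `|D^T *m (1%:M - E)|.
have c40 : 0 <= c4 by rewrite addr_ge0 // !mulr_ge0 // addr_ge0 // ltW.
pose c := c2 + c3 + c4.
have c2c : c2 <= c by rewrite /c; lra.
have c3c : c3 <= c by rewrite /c; lra.
have c4c : c4 <= c by rewrite /c; lra.
have m0 : 0 < Num.min l 1 by rewrite lt_min l0 ltr01.
have [|||a] := @sard_counting R n Rel c (Num.min l 1) m0.
- move=> z a [q [v [i [[a1 Fq _ ->] _]]]]; apply: le_trans c4c.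
  apply: le_trans (ler_normD _ _) _; apply: lerD.
    apply: le_trans (norm_mulmx _ _) _; apply: ler_wpM2r => //; apply: ler_wpM2l => //.
    have := FixK _ Fq; rewrite /cube /= => qy.
    by rewrite -[q](subrK y0) addrC (le_trans (ler_normD _ _)) // lerD2l.
  apply: le_trans (norm_mulmx _ _) _; apply: ler_wpM2r => //.
  by rewrite -[leRHS]mulr1; apply: ler_wpM2l.
- move=> z a z' a' [q [v [i [[a1 Fq g0 zq] _]]]] [q' [v' [i' [[_ Fq' g0' zq'] _]]]].
  apply: le_trans (a_lip _ _ _ _ _ _ a1 Fq Fq' zq zq' g0 g0') _.
  exact: ler_wpM2r.
- move=> z a [q [v [i [[a1 Fq g0 zq] [vA vH vi v1]]]]]; exists v; exists i => //.
  move=> z' a' [q' [v' [i' [[_ Fq' g0' zq'] _]]]].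
  apply: le_trans (v_flat _ _ _ _ _ _ _ a1 Fq Fq' zq zq' g0 g0' vA vH v1) _.
  by apply: ler_wpM2r => //; exact: exprn_ge0.
rewrite le_min => /andP[al a1] nRel; exists a => // q Fq g0 v vA vH.
apply/eqP/negPn/negP => v0.
have [b [i [vi v1]]] := exists_unit_entry v0.
apply: (nRel (zmap q a)); exists q, (b *: v), i; split; split=> //.
  by rewrite -scalemxAl vA.
by rewrite linearZ /= -scalemxAr vH scaler0.
Qed.

End GenericCovector.

(** * Nondegeneracy of block matrices *)

Section LinearAlgebra.
Context {R : realType} {n : nat}.
Implicit Types (A B S : 'M[R]_n) (u v : 'rV[R]_n).

Lemma mulmx_trmx_eq0 m (w : 'rV[R]_m) : w *m w^T = 0 -> w = 0.
Proof.
move/matrixP/(_ 0 0); rewrite !mxE => /eqP.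
rewrite psumr_eq0 => [/allP w0|i _]; last by rewrite mxE -expr2 sqr_ge0.
apply/rowP => i; rewrite mxE; have := w0 i (mem_index_enum i).
by rewrite /= mxE mulf_eq0 orbb => /eqP.
Qed.

(** Passing from one side to the other takes the place of the symmetry of second
    derivatives.  The restriction of B to the image of A is extended by a form
    that is definite on the kernel of A, and the resulting square matrix has a
    null vector on the left if and only if it has one on the right. *)
Lemma nondegenerate_left A B : A *m A = A -> A *m B = B *m A^T ->
  (forall v, v *m A = v -> B *m v^T = 0 -> v = 0) ->
  forall u, u *m A = u -> u *m B = 0 -> u = 0.
Proof.
move=> AA AB right u uA uB; apply/eqP/negPn/negP => u0.
pose X := A *m B *m A^T + (1%:M - A) *m (1%:M - A)^T.
have A1 : A *m (1%:M - A) = 0 by rewrite mulmxBr mulmx1 AA subrr.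
have uX : u *m X = 0.
  by rewrite /X mulmxDr !mulmxA uA uB mul0mx mulmxBr mulmx1 uA subrr mul0mx addr0.
have : \det X^T == 0.
  by rewrite det_tr; apply/det0P; exists u.
move/det0P => [v v0 vX]; move/negP: v0; apply.
have Xv : X *m v^T = 0 by apply: trmx_inj; rewrite trmx_mul trmxK vX trmx0.
have AXv : A *m B *m A^T *m v^T = 0.
  have := congr1 (mulmx A) Xv; rewrite mulmx0 /X mulmxDl mulmxDr !mulmxA AA.
  by rewrite A1 !mul0mx addr0.
have vA : v *m A = v.
  have : v *m (1%:M - A) *m (v *m (1%:M - A))^T = 0.
    move: Xv; rewrite /X mulmxDl AXv add0r trmx_mul => E.
    by rewrite -!mulmxA [X in v *m X]mulmxA E mulmx0.
  move/mulmx_trmx_eq0; rewrite mulmxBr mulmx1 => /eqP; rewrite subr_eq0.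
  by move/eqP.
apply/eqP/right => //.
have Av : A^T *m v^T = v^T by rewrite -trmx_mul vA.
by rewrite -{1}Av mulmxA -AB -Av !mulmxA.
Qed.

Lemma poly_neq0_near (p : {poly R}) : p != 0 -> \forall t \near 0^', p.[t] != 0.
Proof.
move=> p0; have [m [q]] := multiplicity_XsubC p 0.
rewrite p0 /= => q0 ->.
have qn : \forall t \near 0^', q.[t] != 0.
  apply: nbhs_dnbhs; apply: (@cvgr_neq0 _ _ _ _ (nbhs_filter 0) _ _ (@continuous_horner R q 0)).
  exact: q0.
near=> t; rewrite hornerM mulf_neq0 //; first by near: t.
rewrite horner_exp hornerXsubC subr0 expf_neq0 //.
by near: t; exact: nbhs_dnbhs_neq.
Unshelve. all: by end_near. Qed.

(** With respect to the decomposition given by A, the matrix B + t S has the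
    blocks of B on the image of A and those of B + t S on the kernel of A, where
    S is definite.  Dividing the latter by t and letting 1/t tend to 0 shows that
    the determinant is a nonzero polynomial in t. *)
Lemma det_near_neq0 A B S : A *m A = A -> A *m B = B *m A^T ->
  (forall u, u *m A = u -> u *m B = 0 -> u = 0) ->
  A *m S = 0 -> S *m A^T = 0 -> (forall v, v *m S = 0 -> v *m A = v) ->
  \forall t \near 0^', \det (B + t *: S) != 0.
Proof.
move=> AA AB left AS SA Sdef.
pose pencil (X Y : 'M[R]_n) : {poly R} :=
  \det (map_mx polyC X + 'X *: map_mx polyC Y).
have pencilE X Y t : (pencil X Y).[t] = \det (X + t *: Y).
  rewrite -horner_evalE -det_map_mx; congr (\det _); apply/matrixP => i j.
  by rewrite !mxE /= horner_evalE hornerD hornerM hornerX !hornerC.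
have q0 : pencil B S != 0.
  have N0 : \det (A *m B + S) != 0.
    apply/negP => /det0P [v v0 vN]; move/negP: v0; apply.
    have vAB : v *m A *m B = 0.
      have := congr1 (mulmx^~ A^T) vN; rewrite mul0mx mulmxDr mulmxDl.
      by rewrite -[v *m S *m _]mulmxA SA mulmx0 addr0 -!mulmxA -AB !mulmxA -[v *m A *m A]mulmxA AA.
    have vA : v *m A = 0 by apply: left vAB; rewrite -mulmxA AA.
    have vS : v *m S = 0 by move: vN; rewrite mulmxDr mulmxA vA mul0mx add0r.
    by rewrite -(Sdef _ vS) vA.
  have p0 : pencil (A *m B + S) ((1%:M - A) *m B) != 0.
    apply: contraNneq N0 => p0.
    by have := pencilE (A *m B + S) ((1%:M - A) *m B) 0; rewrite p0 horner0 scale0r addr0 => <-.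
  have [s [s0 ps]] : exists s : R, s != 0 /\ (pencil (A *m B + S) ((1%:M - A) *m B)).[s] != 0.
    near ((0 : R)^') => s; exists s; split; near: s.
      exact: nbhs_dnbhs_neq.
    exact: poly_neq0_near.
  apply: contraNneq ps => q0; rewrite pencilE.
  have -> : A *m B + S + s *: ((1%:M - A) *m B) =
      (A + s *: (1%:M - A)) *m (B + s^-1 *: S).
    have KS : (1%:M - A) *m S = S by rewrite mulmxBl mul1mx AS subr0.
    rewrite [RHS]mulmxDl [A *m (_ + _)]mulmxDr -[A *m (_ *: _)]scalemxAr AS scaler0 addr0.
    rewrite -[X in _ = _ + X]scalemxAl [(1%:M - A) *m (_ + _)]mulmxDr -scalemxAr KS.
    by rewrite [X in _ = _ + X]scalerDr scalerA mulfV // scale1r addrAC addrA.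
  by rewrite det_mulmx -(pencilE B S) q0 horner0 mulr0.
have := poly_neq0_near q0; apply: filterS => t.
by rewrite pencilE.
Unshelve. all: by end_near. Qed.

End LinearAlgebra.

(** * Linearization of an action at a fixed point *)

Section LocalAction.
Context {R : realType}.

Lemma pd_coord n (i j : 'I_n) (x : 'rV[R]_n) :
  pd i (fun y : 'rV[R]_n => y 0 j) x = (i == j)%:R.
Proof.
have := @derive_mx R _ 1 n (id : 'rV[R]_n -> _) x (delta_mx 0 i) (@derivable_id R _ x (delta_mx 0 i)).
rewrite derive_id => /(congr1 (fun A : 'rV_n => A 0 j)); rewrite [RHS]mxE /pd => <-.
by rewrite mxE eqxx eq_sym.
Qed.

Lemma jacm_id n (x : 'rV[R]_n) : jacm id x = 1%:M.
Proof. by apply/matrixP => i j; rewrite [LHS]mxE pd_coord mxE. Qed.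

(** A square vanishes to first order where its root does. *)
Lemma grad_hessm_sum_squares n (U : set 'rV[R]_n) (I : Type) (s : seq I)
    (psi : I -> 'rV[R]_n -> R) x : open U -> (forall k, smooth_on U (psi k)) ->
  U x -> (forall k, psi k x = 0) ->
  grad (fun y => \sum_(k <- s) psi k y * psi k y) x = 0 /\
  hessm (fun y => \sum_(k <- s) psi k y * psi k y) x =
    2%:R *: \sum_(k <- s) (grad (psi k) x)^T *m grad (psi k) x.
Proof.
move=> oU spsi Ux psi0.
have d0 k y : U y -> differentiable (psi k) y.
  exact: smooth_on_differentiable (spsi k).
have d1 k j y : U y -> differentiable (pd j (psi k)) y.
  exact: smooth_on_differentiable (smooth_on_pd j (spsi k)).
have dsq k y : U y -> differentiable (fun y => psi k y * psi k y) y.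
  by move=> Uy; apply: differentiableM; exact: d0.
have pd1 j y : U y -> pd j (fun y => \sum_(k <- s) psi k y * psi k y) y =
    \sum_(k <- s) 2 * (psi k y * pd j (psi k) y).
  move=> Uy; rewrite pd_sum; last by move=> k; exact: dsq.
  by apply: eq_bigr => k _; rewrite pdM; [ring|exact: d0|exact: d0].
split; first by apply/rowP => j; rewrite !mxE pd1 // big1 // => k _; rewrite psi0 mul0r mulr0.
apply/matrixP => i j; rewrite mxE.
rewrite (pd_ext (g := fun y => \sum_(k <- s) 2 * (psi k y * pd j (psi k) y)) i oU _ Ux); last first.
  by move=> y /set_mem Uy; exact: pd1.
have dpp k y : U y -> differentiable (fun y => psi k y * pd j (psi k) y) y.
  by move=> Uy; apply: differentiableM; [exact: d0|exact: d1].
rewrite pd_sum; last first.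
  by move=> k; apply: differentiableM; [exact: differentiable_cst|exact: dpp].
rewrite mxE summxE mulr_sumr; apply: eq_bigr => k _.
rewrite pdZ; last exact: dpp.
rewrite pdM; [|exact: d0|exact: d1].
by rewrite psi0 mul0r add0r [in RHS]mxE big_ord1 !mxE mulrC [X in X * _]mulrC mulrC.
Qed.

(** A form of the chain rule for fixed points, where phi x = x is an equation
    between distinct terms. *)
Lemma hessm_comp_at m k (V : set 'rV[R]_m) (W : set 'rV[R]_k)
    (F : 'rV[R]_k -> R) (phi : 'rV[R]_m -> 'rV[R]_k) x z :
  open V -> vsmooth_on V phi -> smooth_on W F ->
  (forall y, V y -> W (phi y)) -> V x -> phi x = z -> grad F z = 0 ->
  hessm (F \o phi) x = jacm phi x *m hessm F z *m (jacm phi x)^T.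
Proof. by move=> oV sphi sF VW Vx <-; exact: hessm_comp oV sphi sF VW Vx. Qed.

Context {n : nat} {G : finGroupType}.
Variables (H : {group G}) (U : set 'rV[R]_n) (phi : G -> 'rV[R]_n -> 'rV[R]_n).
Hypotheses (oU : open U) (sphi : forall h, h \in H -> vsmooth_on U (phi h)).
Hypothesis phi1 : forall y, U y -> phi 1%g y = y.
Hypothesis phiM : forall g h y, g \in H -> h \in H -> U y -> U (phi g y) ->
  phi (g * h)%g y = phi h (phi g y).

Definition fixed (q : 'rV[R]_n) := forall h, h \in H -> phi h q = q.

Definition avg (y : 'rV[R]_n) : 'rV[R]_n := #|H|%:R^-1 *: \sum_(h in H) phi h y.

(** The sum of the squared distances of the translates of y to their average: it
    vanishes on the fixed set and grows quadratically in the normal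
    directions. *)
Definition dev (y : 'rV[R]_n) : R :=
  \sum_(h in H) \sum_i (phi h y 0 i - avg y 0 i) * (phi h y 0 i - avg y 0 i).

Definition invariant_on (F : 'rV[R]_n -> R) :=
  forall h y, h \in H -> U y -> U (phi h y) -> F (phi h y) = F y.

Let cardH : #|H|%:R != 0 :> R.
Proof. by rewrite pnatr_eq0 -lt0n cardG_gt0. Qed.

Lemma avg_fixed q : fixed q -> avg q = q.
Proof.
move=> fq; rewrite /avg (eq_bigr (fun=> q)) => [|h hH]; last exact: fq.
by rewrite sumr_const -[q *+ _]scaler_nat scalerA mulVf // scale1r.
Qed.

Let elt (k : 'I_#|H|) : G := enum_val k.

Let eltH k : elt k \in H. Proof. exact: enum_valP. Qed.

Lemma avg_coordE j y : avg y 0 j = #|H|%:R^-1 * \sum_k phi (elt k) y 0 j.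
Proof. by rewrite /avg mxE summxE big_enum_val. Qed.

Definition dev_coord (ki : 'I_#|H| * 'I_n) (y : 'rV[R]_n) : R :=
  phi (elt ki.1) y 0 ki.2 - avg y 0 ki.2.

Lemma dev_sum y : dev y = \sum_ki dev_coord ki y * dev_coord ki y.
Proof. by rewrite /dev big_enum_val pair_big. Qed.

Lemma vsmooth_avg : vsmooth_on U avg.
Proof.
move=> j; apply/smooth_closureP => //.
apply: (@sc_ext _ _ _ (fun y => #|H|%:R^-1 * \sum_k phi (elt k) y 0 j)).
  by move=> y _; rewrite avg_coordE.
by apply/sc_scale/sc_sum => k; exact/sc_base/sphi.
Qed.

Lemma smooth_dev_coord ki : smooth_on U (dev_coord ki).
Proof.
apply/smooth_closureP => //.
have s1 := sc_base (sphi (eltH ki.1) ki.2).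
have s2 := sc_scale (-1) (sc_base (vsmooth_avg ki.2)).
by apply: sc_ext (sc_add s1 s2) => y _; rewrite /= mulN1r.
Qed.

Lemma smooth_dev : smooth_on U dev.
Proof.
apply/smooth_closureP => //.
apply: (@sc_ext _ _ _ (fun y => \sum_ki dev_coord ki y * dev_coord ki y)).
  by move=> y _; rewrite dev_sum.
apply: sc_sum => ki; have := sc_base (smooth_dev_coord ki) => s1.
exact: (sc_mul s1 s1).
Qed.

Lemma avg_invariant h y : h \in H -> U y -> U (phi h y) -> avg (phi h y) = avg y.
Proof.
move=> hH Uy Uhy; rewrite /avg; congr (_ *: _).
rewrite [RHS](reindex_inj (mulgI h)) /=.
apply: eq_big => [g|g gH]; first by rewrite groupMl.
by rewrite phiM.
Qed.

Section FixedPoint.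
Variable q : 'rV[R]_n.
Hypotheses (Uq : U q) (fq : fixed q).

Let D h := jacm (phi h) q.
Let A := jacm avg q.

Lemma phi_differentiable h j y : h \in H -> U y -> differentiable (fun y => phi h y 0 j) y.
Proof. by move=> hH; exact: smooth_on_differentiable (sphi hH j). Qed.

Lemma near_fixed h : h \in H ->
  exists V, [/\ open V, V q & forall y, V y -> U y /\ U (phi h y)].
Proof.
move=> hH; have Uh : \forall y \near q, U (phi h y).
  have cph : {for q, continuous (phi h)}.
    apply: differentiable_continuous; apply: differentiable_row => j.
    exact: phi_differentiable.
  by apply: cph; rewrite fq //; apply: open_nbhs_nbhs.
have UU : \forall y \near q, U y by apply: open_nbhs_nbhs.
exists [set y | U y /\ U (phi h y)]^°; split; [exact: open_interior|exact: filterI|].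
by move=> y /interior_subset.
Qed.

Lemma jacm_phi1 : D 1%g = 1%:M.
Proof.
rewrite /D -(jacm_id q); apply: jacm_ext oU _ Uq => y /set_mem Uy.
exact: phi1.
Qed.

Lemma jacm_phiM g h : g \in H -> h \in H -> D (g * h)%g = D g *m D h.
Proof.
move=> gH hH; have [V [oV Vq VU]] := near_fixed gH.
have -> : D (g * h)%g = jacm (phi h \o phi g) q.
  by apply: jacm_ext oV _ Vq => y /set_mem /VU[Uy Ugy]; exact: phiM.
rewrite jacm_comp => [|j|j]; first by rewrite fq.
  exact: phi_differentiable.
by rewrite fq //; exact: phi_differentiable.
Qed.

(** The differentials D h form a linear representation of H, so that the
    differential A of avg is the projection onto its invariants. *)
Lemma jacm_avgE : A = #|H|%:R^-1 *: \sum_(h in H) D h.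
Proof.
apply/matrixP => i j; rewrite mxE [RHS]mxE summxE.
have -> : (fun y => avg y 0 j) = fun y => #|H|%:R^-1 * \sum_k phi (elt k) y 0 j.
  by apply/funext => y; rewrite avg_coordE.
have dk k : differentiable (fun y => phi (elt k) y 0 j) q.
  by apply: phi_differentiable => //; exact: eltH.
rewrite pdZ; last exact: differentiable_bigsum.
rewrite pd_sum; last exact: dk.
by rewrite [in RHS]big_enum_val; congr (_ * _); apply: eq_bigr => k _; rewrite mxE.
Qed.

Lemma jacm_mul_avg h : h \in H -> D h *m A = A.
Proof.
move=> hH; rewrite jacm_avgE -scalemxAr; congr (_ *: _).
rewrite mulmx_sumr [RHS](reindex_inj (mulgI h)) /=.
apply: eq_big => [g|g gH]; first by rewrite groupMl.
by rewrite jacm_phiM.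
Qed.

Lemma avg_mul_jacm h : h \in H -> A *m D h = A.
Proof.
move=> hH; rewrite jacm_avgE -scalemxAl; congr (_ *: _).
rewrite mulmx_suml [RHS](reindex_inj (mulIg h)) /=.
apply: eq_big => [g|g gH]; first by rewrite groupMr.
by rewrite jacm_phiM.
Qed.

Lemma mul_avg_id (X : 'M[R]_n) :
  (forall h, h \in H -> D h *m X = X) -> A *m X = X.
Proof.
move=> DX; rewrite jacm_avgE -scalemxAl mulmx_suml (eq_bigr (fun=> X)) //.
by rewrite sumr_const -[X *+ _]scaler_nat scalerA mulVf // scale1r.
Qed.

Lemma jacm_avg_idem : A *m A = A.
Proof. by apply: mul_avg_id => h; exact: jacm_mul_avg. Qed.

(** The Hessian B of an invariant function satisfies D h B (D h)^T = B; averaging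
    over h shows that A B and B A^T are both equal to A B A^T. *)
Lemma hessm_invariant F : smooth_on U F -> invariant_on F -> grad F q = 0 ->
  A *m hessm F q = hessm F q *m A^T.
Proof.
move=> sF iF gF; set B := hessm F q.
have DBD h : h \in H -> D h *m B *m (D h)^T = B.
  move=> hH; have [V [oV Vq VU]] := near_fixed hH.
  have sphV : vsmooth_on V (phi h).
    by move=> j; apply: smooth_on_sub (sphi hH j) => y /VU[].
  have E : hessm (F \o phi h) q = D h *m B *m (D h)^T.
    exact: hessm_comp_at oV sphV sF (fun y Vy => (VU y Vy).2) Vq (fq hH) gF.
  rewrite -E.
  have E2 : hessm (F \o phi h) q = B.
    apply: hessm_ext oV _ Vq => y /set_mem Vy.
    by have [Uy Uhy] := VU _ Vy; exact: iF.
  exact: E2.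
have ABD h : h \in H -> A *m B *m (D h)^T = A *m B.
  by move=> hH; rewrite -{2}(DBD h hH) !mulmxA avg_mul_jacm.
have DBA h : h \in H -> D h *m (B *m A^T) = B *m A^T.
  move=> hH; have DA : (D h)^T *m A^T = A^T by rewrite -trmx_mul avg_mul_jacm.
  by rewrite -{2}(DBD h hH) -!mulmxA DA.
have ABA : A *m (A *m B)^T = (A *m B)^T.
  by apply: mul_avg_id => h hH; rewrite -{2}(ABD h hH) [in RHS]trmx_mul trmxK.
have := mul_avg_id DBA; move/(congr1 trmx): ABA.
by rewrite trmx_mul trmxK => <- <-; rewrite mulmxA.
Qed.

Lemma dev_jet : grad dev q = 0 /\
  hessm dev q = 2%:R *: \sum_(h in H) (D h - A) *m (D h - A)^T.
Proof.
have dev0 ki : dev_coord ki q = 0.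
  by rewrite /dev_coord avg_fixed // fq ?subrr.
have [g h] := grad_hessm_sum_squares (index_enum _) oU smooth_dev_coord Uq dev0.
rewrite (_ : dev = fun y => \sum_ki dev_coord ki y * dev_coord ki y); last first.
  by apply/funext => y; rewrite dev_sum.
split=> //; rewrite h; congr (_ *: _).
rewrite [RHS]big_enum_val -(pair_bigA _ (fun k i =>
  (grad (dev_coord (k, i)) q)^T *m grad (dev_coord (k, i)) q)) /=.
apply: eq_bigr => k _; apply/matrixP => a b; rewrite summxE [RHS]mxE.
have gE i c : grad (dev_coord (k, i)) q 0 c = (D (elt k) - A) c i.
  rewrite !mxE -[LHS]/(pd c (fun y => phi (elt k) y 0 i - avg y 0 i) q).
  have d1 := phi_differentiable i (eltH k) Uq.
  have d2 := smooth_on_differentiable (vsmooth_avg i) Uq.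
  by rewrite /pd deriveB //; exact: diff_derivable.
by apply: eq_bigr => i _; rewrite mxE big_ord1 [(grad _ _)^T _ _]mxE !gE [_^T _ _]mxE.
Qed.

(** The Hessian of dev is twice the sum of the (D h - A) (D h - A)^T, which A
    kills.  This is a sum of positive forms; a null vector of it is a null vector
    of each of them, in particular of the one for h = 1, where D h = 1. *)
Lemma dev_hessm_ker :
  [/\ A *m hessm dev q = 0, hessm dev q *m A^T = 0 &
      forall v : 'rV[R]_n, v *m hessm dev q = 0 -> v *m A = v].
Proof.
have [_ ->] := dev_jet.
have AD h : h \in H -> A *m (D h - A) = 0.
  by move=> hH; rewrite mulmxBr avg_mul_jacm // jacm_avg_idem subrr.
split.
- rewrite -scalemxAr mulmx_sumr big1 ?scaler0 // => h hH.
  by rewrite mulmxA AD // mul0mx.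
- rewrite -scalemxAl mulmx_suml big1 ?scaler0 // => h hH.
  by rewrite -mulmxA -trmx_mul AD // trmx0 mulmx0.
move=> v; rewrite -scalemxAr => /eqP; rewrite scaler_eq0 pnatr_eq0 /= => /eqP vS.
have : (\sum_(h in H) v *m (D h - A) *m (v *m (D h - A))^T) 0 0 = 0.
  transitivity ((v *m (\sum_(h in H) (D h - A) *m (D h - A)^T) *m v^T) 0 0); last first.
    by rewrite vS mul0mx mxE.
  rewrite mulmx_sumr mulmx_suml; congr (fun_of_matrix _ 0 0).
  by apply: eq_bigr => h _; rewrite trmx_mul !mulmxA.
have sq (w : 'rV[R]_n) : 0 <= (w *m w^T) 0 0.
  by rewrite mxE; apply: sumr_ge0 => i _; rewrite mxE -expr2 sqr_ge0.
rewrite summxE => /eqP; rewrite psumr_eq0 => [/allP w0|h _]; last exact: sq.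
have := w0 1%g (mem_index_enum _); rewrite group1 /= => /eqP w1.
have : v *m (D 1%g - A) = 0.
  apply: mulmx_trmx_eq0; apply/matrixP => i j; rewrite !ord1 w1.
  by rewrite mxE.
by rewrite jacm_phi1 mulmxBr mulmx1 => /eqP; rewrite subr_eq0 => /eqP.
Qed.

End FixedPoint.
End LocalAction.

(** * Local density *)

Section LocalDensity.
Context {R : realType} {n : nat}.

Lemma jet_add_scale (U : set 'rV[R]_n) (F g : 'rV[R]_n -> R) t x :
  open U -> smooth_on U F -> smooth_on U g -> U x ->
  grad (fun y => F y + t * g y) x = grad F x + t *: grad g x /\
  hessm (fun y => F y + t * g y) x = hessm F x + t *: hessm g x.
Proof.
move=> oU sF sg Ux.
have stg : smooth_on U (fun y => t * g y).
  by apply/smooth_closureP => //; apply/sc_scale/sc_base.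
have E s : pderiv s (fun y => F y + t * g y) x = pderiv s F x + t * pderiv s g x.
  by rewrite -(pderiv_scale _ _ oU sg Ux) -(pderivD _ oU sF stg Ux).
split; first by apply/rowP => i; rewrite !mxE -(E [:: i]).
by apply/matrixP => i j; rewrite !mxE -(E [:: i; j]).
Qed.

(** In the application, X is the set of the critical points in the fixed set.
    The linear map u |-> (u B, u (1 - A)) is injective, hence bounded below,
    whereas u = q' - q makes it quadratically small. *)
Lemma isolated_critical (A B : 'M[R]_n) (L : R) (q : 'rV[R]_n) (X : set 'rV[R]_n) :
  (forall u : 'rV[R]_n, u *m A = u -> u *m B = 0 -> u = 0) -> 0 <= L ->
  (forall q', X q' -> `|q' - q - (q' - q) *m A| <= L * `|q' - q| ^+ 2) ->
  (forall q', X q' -> `|(q' - q) *m B| <= L * `|q' - q| ^+ 2) ->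
  \forall q' \near q, X q' -> q' = q.
Proof.
move=> nd L0 XA XB.
have /row_freeP [Z BZ] : row_free (row_mx B (1%:M - A)).
  apply: inj_row_free => v; rewrite mul_mx_row -(@row_mx0 R 1 n n).
  move=> /eq_row_mx [vB vA]; apply: nd => //.
  by move: vA; rewrite mulmxBr mulmx1 => /eqP; rewrite subr_eq0 eq_sym => /eqP.
pose c : R := (n + n)%:R * L * `|Z| + 1.
have c0 : 0 < c by rewrite ltr_wpDl // !mulr_ge0.
near=> q' => Xq'; apply/eqP; rewrite -subr_eq0 -normr_le0.
have d1 : `|q' - q| < c^-1.
  near: q'; apply/nbhs_ballP; exists c^-1; first by rewrite /= invr_gt0.
  by move=> y; rewrite -ball_normE /= distrC.
set d := `|q' - q| in d1 *; have dge0 : 0 <= d by exact: normr_ge0.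
have rowle : `|(q' - q) *m row_mx B (1%:M - A)| <= L * d ^+ 2.
  rewrite mul_mx_row; apply: norm_le_mx => [|i j]; first by rewrite mulr_ge0 // exprn_ge0.
  rewrite ord1 mxE; case: splitP => k _.
    exact: le_trans (le_norm_mx _ _ _) (XB _ Xq').
  apply: le_trans (le_norm_mx _ _ _) _; rewrite mulmxBr mulmx1.
  exact: XA.
have dle : d <= c * d ^+ 2.
  rewrite /d -{1}[q' - q]mulmx1 -BZ mulmxA -/d.
  apply: le_trans (norm_mulmx _ _) _.
  have h1 := ler_wpM2l (ler0n R (n + n)) rowle.
  have h2 := ler_wpM2r (normr_ge0 Z) h1.
  apply: le_trans h2 _; rewrite /c mulrDl mul1r.
  have -> : (n + n)%:R * (L * d ^+ 2) * `|Z| = (n + n)%:R * L * `|Z| * d ^+ 2 by ring.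
  by rewrite lerDl exprn_ge0.
rewrite leNgt; apply/negP => dp.
move: dle; rewrite expr2 mulrA ler_pMl // leNgt => /negP; apply.
by rewrite -ltr_pdivlMl // mulr1.
Unshelve. all: by end_near. Qed.

Context {G : finGroupType}.
Variables (H : {group G}) (U : set 'rV[R]_n) (phi : G -> 'rV[R]_n -> 'rV[R]_n).
Hypotheses (oU : open U) (sphi : forall h, h \in H -> vsmooth_on U (phi h)).
Hypothesis phi1 : forall y, U y -> phi 1%g y = y.
Hypothesis phiM : forall g h y, g \in H -> h \in H -> U y -> U (phi g y) ->
  phi (g * h)%g y = phi h (phi g y).
Variable y0 : 'rV[R]_n.
Hypotheses (Uy0 : U y0) (fy0 : fixed H phi y0).

Local Notation avg := (avg H phi).
Local Notation dev := (dev H phi).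
Local Notation fixed := (fixed H phi).

Lemma jacm_avg_near : exists r, [/\ 0 < r, cube y0 r `<=` U &
  forall x, cube y0 r x -> n%:R * `|jacm avg x - jacm avg y0| <= 1 / 2].
Proof.
have e0 : 0 < (2 * n.+1%:R)^-1 :> R by rewrite invr_gt0 mulr_gt0.
have nj : \forall x \near y0, forall ij : 'I_n * 'I_n,
    `|jacm avg x ij.1 ij.2 - jacm avg y0 ij.1 ij.2| < (2 * n.+1%:R)^-1.
  apply: (@filter_forall _ _ _ (nbhs y0)) => -[i j] /=.
  have cij : {for y0, continuous (pd i (fun y => avg y 0 j))}.
    apply: differentiable_continuous.
    exact: smooth_on_differentiable (smooth_on_pd i (vsmooth_avg oU sphi j)) Uy0.
  move/cvgrPdist_lt : cij => /(_ _ e0); apply: filterS => x.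
  by rewrite !mxE distrC.
have UU : \forall x \near y0, U x by apply: open_nbhs_nbhs.
have [r r0 rP] := cube_sub_nbhs (filterI UU nj).
exists r; split=> // [x /rP[]//|x /rP[_ xP]].
have le1 : `|jacm avg x - jacm avg y0| <= (2 * n.+1%:R)^-1.
  apply: norm_le_mx => [|i j]; first exact: ltW.
  by rewrite mxE [X in _ + X]mxE; exact: ltW (xP (i, j)).
apply: le_trans (ler_wpM2l (ler0n R n) le1) _.
rewrite ler_pdivrMr ?mulr_gt0 //.
have -> : n.+1%:R = n%:R + 1 :> R by rewrite natr1.
by have := ler0n R n; lra.
Qed.

(** The covector a is chosen first, by [generic_covector]; then the small t that
    are suitable form a punctured neighborhood of 0, so that t can be chosen
    small enough for any purpose. *)
Lemma local_density : exists r, [/\ 0 < r, cube y0 r `<=` U &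
  forall F l, smooth_on U F -> invariant_on H U phi F -> 0 < l ->
  exists2 a, `|a| <= l & \forall t \near 0^', forall q, cube y0 r q -> fixed q ->
    regular_at (fun y => combination F avg a y + t * dev y) q].
Proof.
have [r [r0 KU jn]] := jacm_avg_near.
exists r; split=> // F l sF iF l0.
pose Fix := [set q | cube y0 r q /\ fixed q].
have FixP q : Fix q -> cube y0 r q /\ avg q = q.
  by case=> qK fq; split=> //; exact: avg_fixed.
have sA := vsmooth_avg oU sphi.
have sD := smooth_dev oU sphi.
have l10 : 0 < Num.min l 1 by rewrite lt_min l0 ltr01.
have idem := jacm_avg_idem oU sphi phiM Uy0 fy0.
have [a al gen] := generic_covector r0 l10 oU KU sF sA FixP idem jn.
move: al; rewrite le_min => /andP[al a1].
exists a => //; set F1 := combination F avg a.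
have sF1 : smooth_on U F1.
  apply/smooth_closureP => //; apply: (sc_add (sc_base sF)).
  by apply: sc_sum => i; apply: (@sc_scale _ _ _ (a 0 i) (fun y => avg y 0 i)); exact: sc_base.
have iF1 : invariant_on H U phi F1.
  move=> h y hH Uy Uhy; rewrite /F1 /combination iF //.
  by rewrite (avg_invariant phiM hH Uy Uhy).
have [L1 L10 est] := gradient_estimates r0 oU KU sF sA.
have [L2 L20 est2] := smooth_estimates r0 KU sA.
have jets t q : cube y0 r q -> fixed q ->
    grad (fun y => F1 y + t * dev y) q = grad F1 q /\
    hessm (fun y => F1 y + t * dev y) q = hessm F1 q + t *: hessm dev q.
  move=> /KU Uq fq; have [-> ->] := jet_add_scale t oU sF1 sD Uq.
  by have [-> _] := dev_jet oU sphi Uq fq; rewrite scaler0 addr0.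
have cK := @compact_cube R n y0 r r0.
move/compact_near_coveringP in cK.
have FD : Filter ((0 : R)^') by exact: dnbhs_filter.
pose P (t : R) q := fixed q -> cube y0 r q -> regular_at (fun y => F1 y + t * dev y) q.
suff : \forall t \near 0^', cube y0 r `<=` P t.
  by apply: filterS => t tP q qK fq; exact: tP.
(* By compactness it suffices to treat the points near a given q.  The cases are:
   q is not fixed, q is fixed but not critical, q is fixed and critical. *)
apply: (cK R ((0 : R)^') P FD) => q qK.
have Uq := KU _ qK.
have [fq|nfq] := pselect (fixed q); last first.
  have [h hH hq] : exists2 h, h \in H & phi h q <> q.
    apply: contrapT => ne; apply: nfq => h hH; apply: contrapT => hq; apply: ne.
    by exists h.
  have cph : {for q, continuous (fun y => phi h y - y)}.
    apply: differentiable_continuous; apply: differentiableB => //.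
    apply: differentiable_row => j.
    exact: smooth_on_differentiable (sphi hH j) Uq.
  have hq0 : phi h q - q != 0 by rewrite subr_eq0; apply/eqP.
  have nfix := @cvgr_neq0 _ _ _ _ (nbhs_filter q) _ _ cph hq0.
  near=> q' t => fq'; exfalso.
  suff /eqP : phi h q' - q' != 0 by rewrite fq' // subrr.
  by near: q'.
have [g0|g0] := eqVneq (grad F1 q) 0; last first.
  have cg : {for q, continuous (grad F1)}.
    apply: differentiable_continuous; apply: differentiable_row => j.
    rewrite (_ : (fun y => grad F1 y 0 j) = pd j F1).
      exact: smooth_on_differentiable (smooth_on_pd j sF1) Uq.
    by apply/funext => y; rewrite mxE.
  have ng := @cvgr_neq0 _ _ _ _ (nbhs_filter q) _ _ cg g0.
  near=> q' t => fq' q'K; left.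
  by have [-> _] := jets t q' q'K fq'; near: q'.
set A := jacm avg q; set B := hessm F1 q.
have AA : A *m A = A := jacm_avg_idem oU sphi phiM Uq fq.
have AB : A *m B = B *m A^T := hessm_invariant oU sphi phiM Uq fq sF1 iF1 g0.
have left := nondegenerate_left AA AB (gen q (conj qK fq) g0).
have [AS SA Sker] := dev_hessm_ker oU sphi phi1 phiM Uq fq.
have dett := det_near_neq0 AA AB left AS SA Sker.
pose X := [set q' | [/\ cube y0 r q', fixed q' & grad F1 q' = 0]].
have iso : \forall q' \near q, X q' -> q' = q.
  apply: (isolated_critical (L := L1 + L2) left); first exact: addr_ge0.
  - move=> q' [q'K fq' _].
    apply: (@le_trans _ _ (L2 * `|q' - q| ^+ 2)); last first.
      by apply: ler_wpM2r; rewrite ?exprn_ge0 // lerDr.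
    apply: norm_le_mx => [|i j]; first by rewrite mulr_ge0 // exprn_ge0.
    have := (est2 j q q' qK q'K).2; rewrite !avg_fixed // ord1.
    congr (`|_| <= _); rewrite !mxE; congr (_ - _).
    by apply: eq_bigr => k _; rewrite [A _ _]mxE.
  - move=> q' [q'K fq' g0'].
    apply: (@le_trans _ _ (L1 * `|q' - q| ^+ 2)); last first.
      by apply: ler_wpM2r; rewrite ?exprn_ge0 // lerDl.
    by have [_ + _] := est a q q' a1 qK q'K; rewrite g0 g0' subr0 sub0r normrN.
(* Since q is isolated, a single determinant has to be nonzero; a continuity
   argument would not be uniform in t. *)
near=> q' t => fq' q'K; have [gq' hq'] := jets t q' q'K fq'.
have [g0'|g0'] := eqVneq (grad F1 q') 0; last by left; rewrite gq'.
have -> : q' = q by apply: (near iso q').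
right; have [_ ->] := jets t q qK fq.
by near: t.
Unshelve. all: by end_near. Qed.

End LocalDensity.

(** * Invariant smooth functions on the manifold *)

Section SmoothOnManifold.
Context {R : realType} {n : nat} {M : topologicalType}.
Variable S : smooth_structure R n M.

Lemma smooth_local (f : M -> R) :
  (forall c y, atlas S c -> cimg c y -> exists U, [/\ open U, U y & smooth_on U (f \o cinv c)]) ->
  smooth S f.
Proof.
move=> loc c ac; apply: smooth_on_local => y cy.
by have [U [oU Uy sU]] := loc c y ac cy; exists U.
Qed.

Lemma smooth_add (f g : M -> R) : smooth S f -> smooth S g ->
  smooth S (fun p => f p + g p).
Proof.
move=> sf sg c ac; apply/smooth_closureP; first exact: open_cimg.
by apply: (sc_add (f := f \o cinv c) (g := g \o cinv c)); apply: sc_base; [exact: sf|exact: sg].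
Qed.

Lemma smooth_scale b (f : M -> R) : smooth S f -> smooth S (fun p => b * f p).
Proof.
move=> sf c ac; apply/smooth_closureP; first exact: open_cimg.
by apply: (@sc_scale _ _ _ b (f \o cinv c)); apply: sc_base; exact: sf.
Qed.

Lemma smooth_cst b : smooth S (fun=> b).
Proof. by move=> c ac; exact: smooth_on_cst. Qed.

Lemma smooth_sum (I : Type) (r : seq I) (f : I -> M -> R) :
  (forall i, smooth S (f i)) -> smooth S (fun p => \sum_(i <- r) f i p).
Proof.
move=> sf; elim: r => [|i r IHr].
  by rewrite (_ : (fun _ => _) = fun=> 0);
    [exact: smooth_cst|apply/funext => p; rewrite big_nil].
rewrite (_ : (fun _ => _) = fun p => f i p + \sum_(j <- r) f j p).
  exact: smooth_add.
by apply/funext => p; rewrite big_cons.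
Qed.

Lemma smooth_comp_map (f : M -> R) (phi : M -> M) :
  smooth S f -> smooth_map S phi -> smooth S (f \o phi).
Proof.
move=> sf [cphi sphi]; apply: smooth_local => c y ac cy.
have [d [ad dp]] := atlas_cover S (phi (cinv c y)).
pose U := cimg c `&` ((phi \o cinv c) @^-1` cdom d).
have oU : open U.
  have -> : U = cimg c `&` (cinv c @^-1` (phi @^-1` cdom d)) by [].
  apply: open_chart_preimage; apply: open_comp => [x _|]; first exact: cphi.
  exact: open_cdom.
exists U; split=> //; apply/smooth_closureP => //.
apply: (@sc_ext _ _ _ ((f \o cinv d) \o (d \o phi \o cinv c))).
  by move=> z /set_mem [cz dz] /=; rewrite cmapK.
apply: (@sc_comp _ _ _ _ (cimg d)).
- exact: sf.
- by move=> z [cz dz]; exact: cmap_img.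
- by move=> j; apply: sc_base; exact: sphi.
Qed.

Lemma chart_compact_image (c : chart R n M) K : compact K -> K `<=` cimg c ->
  compact (cinv c @` K).
Proof.
move=> cK Kc; apply: continuous_compact => //.
by apply: continuous_in_subspaceT => z /set_mem Kz; exact/cinv_cvg/Kc.
Qed.

(** A smooth function on R^n supported in a compact subset of the image of a
    chart extends by zero to a smooth function; Hausdorffness makes the support
    closed. *)
Lemma smooth_extension (c : chart R n M) (K : set 'rV[R]_n) (e : 'rV[R]_n -> R) :
  hausdorff_space M -> atlas S c -> compact K -> K `<=` cimg c ->
  smooth_on setT e -> (forall y, ~ K y -> e y = 0) ->
  smooth S (fun q => if pselect (cdom c q) then e (c q) else 0).
Proof.
move=> hM ac cK Kc se e0; apply: smooth_local => d y ad dy.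
have [cq|ncq] := pselect (cdom c (cinv d y)).
  exists (transition_dom d c); split; [exact: open_transition_dom|by split|].
  apply/smooth_closureP; first exact: open_transition_dom.
  apply: (@sc_ext _ _ _ (e \o (c \o cinv d))).
    by move=> z /set_mem [dz cz] /=; case: pselect.
  apply: (@sc_comp _ _ _ _ setT) => // j.
  by apply: sc_base; exact: (atlas_smooth ad ac).
have clK : closed (cinv c @` K).
  by apply: compact_closed => //; exact: chart_compact_image.
pose U := cimg d `&` (cinv d @^-1` (~` (cinv c @` K))).
have oU : open U by apply: open_chart_preimage; exact: closed_openC.
exists U; split=> //.
  by split=> // -[z Kz zy]; apply: ncq; rewrite /= -zy; exact/cinv_dom/Kc.
apply: (smooth_on_ext oU _ (@smooth_on_cst R n U 0)) => z /set_mem [dz nK] /=.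
case: pselect => // cz; apply/esym/e0 => Kz; apply: nK.
by exists (c (cinv d z)) => //; rewrite cmapK.
Qed.

End SmoothOnManifold.

Section TotalAction.
Variables (M : Type) (G : finGroupType) (act : {action G &-> M}).

Lemma act_mul p g h : act p (g * h)%g = act (act p g) h.
Proof. by case: act => to [_ toM] /=; apply: toM; rewrite inE. Qed.

Lemma act_one p : act p 1%g = p.
Proof.
have inj : left_injective act by case: act => to [].
by apply: (inj 1%g); rewrite -act_mul mulg1.
Qed.

End TotalAction.

Section EquivariantExtension.
Context {R : realType} {n : nat} {M : topologicalType}.
Variables (S : smooth_structure R n M) (G : finGroupType) (act : {action G &-> M}).
Hypotheses (hM : hausdorff_space M) (sact : smooth_action S act).

Definition stab_set (p : M) : {set G} := [set g | `[< act p g = p >]].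

Lemma stab_group_set p : group_set (stab_set p).
Proof.
apply/group_setP; split; first by rewrite finset.in_set; apply/asboolP; exact: act_one.
move=> g h; rewrite !finset.in_set => /asboolP gp /asboolP hp; apply/asboolP.
by rewrite act_mul gp hp.
Qed.

Canonical stab p := Group (stab_group_set p).

Lemma stabP p g : reflect (act p g = p) (g \in stab p).
Proof. by rewrite finset.in_set; exact: asboolP. Qed.

Lemma act_continuous g : continuous (act^~ g).
Proof. by case: (sact g). Qed.

(** Since M is Hausdorff, p has a neighborhood disjoint from its translate by a
    given element that moves p; the group being finite, one neighborhood serves
    all these elements. *)
Lemma stab_separated p : exists V, [/\ open V, V p &
  forall g q, g \notin stab p -> V q -> ~ V (act q g)].
Proof.
have sep g : exists V, [/\ open V, V p & g \notin stab p -> forall q, V q -> ~ V (act q g)].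
  have [gp|gp] := boolP (g \in stab p); first by exists setT; split; [exact: openT| |].
  have /eqP ne : act p g <> p by move/stabP: gp.
  have := hM; rewrite open_hausdorff => /(_ _ _ ne) [[A B]] /= [/set_mem Ap /set_mem Bp] [oA oB /eqP AB].
  exists (B `&` ((act^~ g) @^-1` A)); split => //.
    apply: openI => //; apply: open_comp => // x _; exact: act_continuous.
  move=> _ q [_ Aq] [Bq _]; suff : (A `&` B) (act q g) by rewrite AB.
  by split.
have [V VP] := choice sep.
exists [set q | forall g, V g q]^°; split; first exact: open_interior.
  apply: (@filter_forall _ _ _ (nbhs p)) => g; have [oV Vp _] := VP g.
  exact: open_nbhs_nbhs.
move=> g q gp /interior_subset Vq /interior_subset Vgq.
by have [_ _ /(_ gp q (Vq g))] := VP g; apply; exact: Vgq.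
Qed.

Definition act_chart (c : chart R n M) (g : G) : 'rV[R]_n -> 'rV[R]_n :=
  c \o act^~ g \o cinv c.

(** Invariant functions with prescribed averages near p: multiply the given
    function by a cutoff whose support is disjoint from its translates by the
    elements that move p, and sum over G. *)
Lemma equivariant_extension (c : chart R n M) (p : M) (W : set 'rV[R]_n) :
  chart_around S p c -> open W -> W (c p) -> W `<=` cimg c ->
  exists U, [/\ open U, U (c p), U `<=` W,
    forall y h, U y -> h \in stab p -> cdom c (act (cinv c y) h) /\ W (act_chart c h y) &
    forall e, smooth_on W e -> exists v : M -> R, [/\ smooth S v,
      forall s, v \o act^~ s = v &
      forall y, U y -> v (cinv c y) = \sum_(h in stab p) e (act_chart c h y)]].
Proof.
move=> [ac cp] oW Wp Wc.
have [V [oV Vp Vsep]] := stab_separated p.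
have WV : nbhs (c p) (W `&` (cimg c `&` (cinv c @^-1` V))).
  apply: filterI; first by apply: open_nbhs_nbhs.
  by apply: nbhs_chart => //; apply: open_nbhs_nbhs.
have [r2 r20 r2W] := cube_sub_nbhs WV.
pose r := r2 / 2; have r0 : 0 < r by rewrite divr_gt0.
have rE : 2 * r = r2 by rewrite /r mulrC divfK.
have [chi [schi chi1 chi0]] := smooth_bump (c p) r0.
rewrite rE in chi0.
pose good y := [/\ W y, V (cinv c y) & forall h : G, h \in stab p ->
  [/\ cdom c (act (cinv c y) h), W (act_chart c h y) & cube (c p) r (act_chart c h y)]].
have good_near : \forall y \near c p, good y.
  have nWV : \forall y \near c p, W y /\ V (cinv c y).
    by apply: filterS WV => y [Wy [_ Vy]].
  have nh : \forall y \near c p, forall h : G, h \in stab p ->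
      [/\ cdom c (act (cinv c y) h), W (act_chart c h y) & cube (c p) r (act_chart c h y)].
    apply: (@filter_forall _ _ _ (nbhs (c p))) => h.
    have [hp|hp] := boolP (h \in stab p); last by apply: filterE => y.
    have hpE : act p h = p by apply/stabP.
    have cact : {for c p, continuous (act^~ h \o cinv c)}.
      apply: continuous_comp; first by apply: cinv_cvg; exact: cmap_img.
      exact: act_continuous.
    have E : (act^~ h \o cinv c) (c p) = p by rewrite /= cmapK // hpE.
    have ccact : {for c p, continuous (act_chart c h)}.
      apply: (continuous_comp (g := c) cact); rewrite E; exact: cmap_cvg.
    have E' : act_chart c h (c p) = c p by rewrite /act_chart /= cmapK // hpE.
    have n1 : \forall y \near c p, cdom c (act (cinv c y) h).
      by apply: cact; rewrite E; exact: nbhs_cdom.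
    have n2 : \forall y \near c p, W (act_chart c h y).
      by apply: ccact; rewrite E'; apply: open_nbhs_nbhs.
    have n3 : \forall y \near c p, cube (c p) r (act_chart c h y).
      by apply: ccact; rewrite E'; exact: nbhs_cube.
    by apply: filterS3 n1 n2 n3 => y y1 y2 y3 _.
  by apply: filterS2 nWV nh => y [Wy Vy] yh.
exists [set y | good y]^°; split.
- exact: open_interior.
- exact: good_near.
- by move=> y /interior_subset [].
- by move=> y h /interior_subset [_ _ /(_ h)] yh /yh [].
move=> e se.
have sce : smooth_on setT (fun y => chi y * e y).
  apply: smooth_on_local => y _.
  have [yK|nyK] := pselect (cube (c p) r2 y).
    exists W; split; first by have [] := r2W _ yK.
    apply/smooth_closureP => //; apply: (sc_mul (f := chi) (g := e)).
      by apply: sc_base; exact: smooth_on_sub schi.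
    exact: sc_base.
  exists [set z | r2 < `|z - c p|]; split; first by rewrite /= ltNge; apply/negP.
  have oz : open [set z : 'rV[R]_n | r2 < `|z - c p|].
    have -> : [set z : 'rV[R]_n | r2 < `|z - c p|] = ~` cube (c p) r2.
      by apply/seteqP; split=> z /=; rewrite /cube /= ltNge => /negP.
    apply: closed_openC; apply: compact_closed; first exact: (@norm_hausdorff R 'rV[R]_n).
    exact: (@compact_cube R n (c p) r2 r20).
  apply: (smooth_on_ext oz _ (@smooth_on_cst R n _ 0)) => z /set_mem /= zr.
  by rewrite chi0 ?mul0r.
have ce0 y : ~ cube (c p) r2 y -> chi y * e y = 0.
  by move=> /negP; rewrite -ltNge => yr; rewrite chi0 ?mul0r.
have r2c : cube (c p) r2 `<=` cimg c by move=> y /r2W [/Wc].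
have sw := smooth_extension hM ac (@compact_cube _ _ (c p) _ r20) r2c sce ce0.
set w := (X in smooth S X) in sw.
exists (fun q => \sum_g w (act q g)); split.
- by apply: smooth_sum => g; exact: (smooth_comp_map sw (sact g)).
- move=> s; apply/funext => q /=; rewrite [RHS](reindex_inj (mulgI s)) /=.
  by apply: eq_bigr => g _; rewrite act_mul.
move=> y /interior_subset [Wy Vy yh].
rewrite (bigID [pred g | g \in stab p]) /= [X in _ + X]big1 ?addr0 => [|g gp].
  apply: eq_bigr => g gp; have [dg _ rg] := yh g gp.
  rewrite /w; case: pselect => // dg0.
  by rewrite -[c (act _ _)]/(act_chart c g y) chi1 ?mul1r.
rewrite /w; case: pselect => // dg; apply: ce0 => /r2W [_ [_ /=]].
by rewrite cmapK //; exact: Vsep.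
Qed.

End EquivariantExtension.

(** * Density *)

Section Density.
Context {R : realType} {n : nat} {M : topologicalType}.
Variables (S : smooth_structure R n M) (G : finGroupType) (act : {action G &-> M}).
Hypotheses (hM : hausdorff_space M) (sact : smooth_action S act).
Variable k : nat.

Local Notation equivariant := (equivariant_functions S act k).

(** The average avg and dev of the action in a chart, multiplied by a cutoff and
    summed over G, provide the invariant perturbations that [local_density] asks
    for.  Two nested neighborhoods U1 and U2 are used: dev is built from avg,
    which has to be smooth and invariant under the stabilizer around U2. *)
Lemma local_perturbation p : exists D, [/\ compact D, nbhs p D &
  forall (f : Cinf S k) O, equivariant f -> nbhs f O ->
  exists g, [/\ equivariant g, O g & forall q, D q ->
    (forall h, h \in stab act p -> act q h = q) -> regular S g q]].
Proof.
pose c := chart_at S p; have cP : chart_around S p c := chart_atP S p.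
have [ac cp] := cP; set y0 := c p.
pose H := stab act p; pose phi := act_chart act c.
have [U1 [oU1 U1p U1c U1H ext1]] :=
  equivariant_extension hM sact cP (@open_cimg _ _ _ c) (cmap_img cp) (fun=> id).
have sphi1 h : h \in H -> vsmooth_on U1 (phi h).
  move=> hH j; apply: smooth_on_sub ((sact h).2 c c ac ac j) => y Uy.
  by split; [exact: U1c|have [] := U1H y h Uy hH].
have phiM1 g h y : g \in H -> h \in H -> U1 y -> U1 (phi g y) ->
    phi (g * h)%g y = phi h (phi g y).
  move=> gH hH Uy _; have [dg _] := U1H y g Uy gH.
  by rewrite /phi /act_chart /= cmapK // act_mul.
have coord_ext i : exists v : M -> R, [/\ smooth S v, forall s, v \o act^~ s = v &
    forall y, U1 y -> v (cinv c y) = \sum_(h in H) phi h y 0 i].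
  have [v [sv iv vE]] := ext1 (fun y => y 0 i) (@smooth_on_coord _ _ _ i).
  by exists v.
have [v vP] := choice coord_ext.
pose u i (q : M) := #|H|%:R^-1 * v i q.
have su i : smooth S (u i) by apply: smooth_scale; have [] := vP i.
have iu i s : u i \o act^~ s = u i.
  have [_ iv _] := vP i.
  by apply/funext => q /=; rewrite /u -{2}(iv s).
have uE i y : U1 y -> u i (cinv c y) = avg H phi y 0 i.
  by move=> Uy; have [_ _ vE] := vP i; rewrite /u vE // /avg mxE summxE.
have [U2 [oU2 U2p U2U1 U2H ext2]] := equivariant_extension hM sact cP oU1 U1p U1c.
pose e (y : 'rV[R]_n) : R := \sum_i (y 0 i - avg H phi y 0 i) * (y 0 i - avg H phi y 0 i).
have se : smooth_on U1 e.
  have sterm i : smooth_closure U1 (fun y => y 0 i - avg H phi y 0 i).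
    have s2 := sc_scale (-1) (sc_base (vsmooth_avg oU1 sphi1 i)).
    by apply: sc_ext (sc_add (sc_coord _ i) s2) => y _; rewrite /= mulN1r.
  by apply/smooth_closureP => //; apply: sc_sum => i; exact: (sc_mul (sterm i) (sterm i)).
have [Q [sQ iQ QE]] := ext2 e se.
have QE' y : U2 y -> Q (cinv c y) = dev H phi y.
  move=> Uy; rewrite QE // /dev; apply: eq_bigr => h hH; apply: eq_bigr => i _.
  rewrite (avg_invariant phiM1 hH) //; first exact: U2U1.
  by have [] := U2H y h Uy hH.
have sphi2 h : h \in H -> vsmooth_on U2 (phi h).
  by move=> hH j; exact: smooth_on_sub U2U1 (sphi1 h hH j).
have phi12 y : U2 y -> phi 1%g y = y.
  by move=> Uy; rewrite /phi /act_chart /= act_one cinvK //; exact/U1c/U2U1.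
have phiM2 g h y : g \in H -> h \in H -> U2 y -> U2 (phi g y) ->
    phi (g * h)%g y = phi h (phi g y).
  by move=> gH hH /U2U1 Uy /U2U1 Ugy; exact: phiM1.
have fy0 : fixed H phi y0.
  move=> h /stabP hp.
  by rewrite /phi /act_chart /y0 /= cmapK // hp.
have [r [r0 rU dens]] := local_density oU2 sphi2 phi12 phiM2 U2p fy0.
have rc : cube y0 r `<=` cimg c by move=> y /rU /U2U1 /U1c.
exists (cinv c @` cube y0 r); split.
- by apply: chart_compact_image rc; exact: compact_cube.
- have near_r : \forall q \near p, cube y0 r (c q) by apply: (cmap_cvg cp); exact: nbhs_cube.
  by apply: filterS2 (nbhs_cdom cp) near_r => q cq qr; exists (c q) => //; rewrite cmapK.
move=> f O ef Of.
pose sf := Cinf_smooth f.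
pose F := f \o cinv c.
have sF : smooth_on U2 F by apply: smooth_on_sub (sf c ac) => y /U2U1 /U1c.
have iF : invariant_on H U2 phi F.
  move=> h y hH Uy _; have [dh _] := U2H y h Uy hH.
  rewrite /F /phi /act_chart /= cmapK //.
  by have /(congr1 (fun g => g (cinv c y))) := ef h.
have n0 : \forall a \near (0 : 'rV[R]_n), O^° (MkCinf k (smooth_lincomb a sf su)).
  have id0 : id @ (0 : 'rV[R]_n) --> (0 : 'rV[R]_n) by exact: cvg_id.
  have := @lincomb_cvg _ _ _ _ _ _ f u su _ (nbhs (0 : 'rV[R]_n)) id (nbhs_filter _) id0.
  move=> cvg_f; exact: (cvg_f _ (nbhs_interior Of)).
have [l l0 lO] := cube_sub_nbhs n0.
have [a al areg] := dens F l sF iF l0.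
pose f1 := MkCinf k (smooth_lincomb a sf su).
have Of1 : nbhs f1 O by apply: lO; rewrite /cube /= subr0.
have sQ1 (i : 'I_1) : smooth S Q by exact: sQ.
have a0 : (fun t : R => const_mx t : 'rV[R]_1) @ (0 : R)^' --> (0 : 'rV[R]_1).
  have : {for (0 : R), continuous (fun t : R => const_mx t : 'rV[R]_1)}.
    apply: differentiable_continuous; apply: differentiable_row => j.
    rewrite (_ : (fun _ => _) = id) //.
    by apply/funext => t; rewrite mxE.
  have E0 : (const_mx 0 : 'rV[R]_1) = 0 by apply/rowP => j; rewrite !mxE.
  by move=> /continuous_withinNx; rewrite E0.
have nO : \forall t \near (0 : R)^', O (MkCinf k (smooth_lincomb (const_mx t) (Cinf_smooth f1) sQ1)).
  have := @lincomb_cvg _ _ _ _ _ _ f1 (fun=> Q) sQ1 _ ((0 : R)^') _ (dnbhs_filter _) a0.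
  move=> cvg_f1; exact: (cvg_f1 O Of1).
have [t [tO treg]] : exists t,
    O (MkCinf k (smooth_lincomb (const_mx t) (Cinf_smooth f1) sQ1)) /\
    forall q, cube y0 r q -> fixed H phi q ->
      regular_at (fun y => combination F (avg H phi) a y + t * dev H phi y) q.
  by near ((0 : R)^') => t; exists t; split; near: t.
exists (MkCinf k (smooth_lincomb (const_mx t) (Cinf_smooth f1) sQ1)); split => //.
  move=> s; apply/funext => q /=; rewrite /lincomb /lincomb !big_ord1.
  have fs : f (act q s) = f q by have /(congr1 (fun g => g q)) := ef s.
  have Qs : Q (act q s) = Q q by have /(congr1 (fun g => g q)) := iQ s.
  rewrite fs Qs; congr (_ + _ + _); apply: eq_bigr => i _; congr (_ * _).
  by have /(congr1 (fun g => g q)) := iu i s.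
move=> q [y yr yq] qfix.
have cy : cimg c y := rc _ yr.
have cq : cdom c q by rewrite -yq; exact: cinv_dom.
have cqy : c q = y by rewrite -yq cinvK.
apply: (regular_chart (Cinf_smooth _) (conj ac cq)); rewrite cqy.
have yfix : fixed H phi y.
  by move=> h hH; rewrite /phi /act_chart /= yq qfix.
apply: regular_at_ext oU2 _ (rU _ yr) (treg y yr yfix) => z /set_mem Uz.
rewrite /= /lincomb big_ord1 mxE QE' //; congr (_ + _ + _).
by apply: eq_bigr => i _; rewrite uE //; exact: U2U1.
Unshelve. all: by end_near. Qed.

End Density.

Section Strata.
Context {R : realType} {n : nat} {M : topologicalType}.
Variables (S : smooth_structure R n M) (G : finGroupType) (act : {action G &-> M}).
Hypotheses (cM : closed_manifold M) (sact : smooth_action S act).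
Variable k : nat.
Hypothesis k_ge2 : (2 <= k)%N.

Local Notation equivariant := (equivariant_functions S act k).

Let hM : hausdorff_space M. Proof. by case: cM. Qed.

(** Stabilizers can only shrink near p. *)
Lemma stab_near p : \forall q \near p, stab act q \subset stab act p.
Proof.
have [V [oV Vp Vsep]] := stab_separated hM sact p.
have nV : nbhs p V by exact: open_nbhs_nbhs.
apply: filterS nV => q Vq; apply/fintype.subsetP => g /stabP gq.
by apply: contraT => gp; have := Vsep g q gp Vq; rewrite gq.
Qed.

Definition stratum m := [set p : M | (m <= #|stab act p|)%N].

Lemma closed_near (A : set M) :
  (forall p, ~ A p -> \forall q \near p, ~ A q) -> closed A.
Proof.
by move=> nA; rewrite -openC openE => p /nA; exact: filterS.
Qed.

Lemma closed_stratum m : closed (stratum m).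
Proof.
apply: closed_near => p /negP; rewrite -ltnNge => pm.
apply: filterS (stab_near p) => q /subset_leq_card qp.
by apply/negP; rewrite -ltnNge; exact: leq_ltn_trans pm.
Qed.

Lemma closed_fixed (H : {group G}) :
  closed [set q | forall h, h \in H -> act q h = q].
Proof.
apply: closed_near => p nfix.
have [h hH hp] : exists2 h, h \in H & h \notin stab act p.
  apply: contrapT => ne; apply: nfix => h hH; apply/stabP.
  by apply: contraT => hp; exfalso; apply: ne; exists h.
apply: filterS (stab_near p) => q qp qfix.
by move/negP: hp; apply; apply: (fintype.subsetP qp); apply/stabP; exact: qfix.
Qed.

(** Asking for the regularity of all functions near g lets a later perturbation
    start from g without destroying it. *)
Definition approximable (C : set M) (f : Cinf S k) :=
  forall O, equivariant f -> nbhs f O ->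
    exists g, [/\ equivariant g, O g &
      \forall h \near g, forall q, C q -> regular S (h : Cinf S k) q].

(** Considering all functions near f allows perturbations on several sets to be
    made in succession, each one starting from the result of the previous
    one. *)
Definition perturbable (f : Cinf S k) (C : set M) :=
  \forall f' \near f, approximable C f'.

Lemma perturbable0 f : perturbable f set0.
Proof.
apply: (@filterE _ (nbhs f)) => f' O ef' Of'; exists f'; split; [by []|exact: nbhs_singleton Of'|].
by apply: (@filterE _ (nbhs f')) => h q [].
Qed.

Lemma perturbable_sub f (C D : set M) : C `<=` D -> perturbable f D -> perturbable f C.
Proof.
move=> CD; apply: (@filterS _ (nbhs f)) => f' Df' O ef' Of'.
have [g [eg Og greg]] := Df' O ef' Of'; exists g; split=> //.
by apply: (@filterS _ (nbhs g)) greg => h hD q /CD; exact: hD.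
Qed.

Lemma perturbableU f (C D : set M) :
  perturbable f C -> perturbable f D -> perturbable f (C `|` D).
Proof.
move=> /nbhs_interior fC /nbhs_interior fD.
apply: (@filterS2 _ (nbhs f)) fC fD => f' f'C f'D O ef' Of'.
pose O1 := O^° `&` [set h | approximable D h]^°.
have nO1 : nbhs f' O1.
  by apply: filterI; [exact: nbhs_interior|exact: nbhs_interior].
have [g1 [eg1 [Og1 Dg1] g1C]] := nbhs_singleton f'C O1 ef' nO1.
pose O2 := O `&` [set h : Cinf S k | forall q, C q -> regular S h q]^°.
have nO2 : nbhs g1 O2 by apply: filterI => //; exact: nbhs_interior.
have [g2 [eg2 [Og2 Cg2] g2D]] := nbhs_singleton Dg1 O2 eg1 nO2.
exists g2; split=> //.
by apply: (@filterS2 _ (nbhs g2)) Cg2 g2D => h hC hD q [/hC|/hD].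
Qed.

(** If K were not perturbable, the sets A with K \ A perturbable would form a
    proper filter on K; this filter clusters at a point of K, whose perturbable
    neighborhood would have a complement in the filter. *)
Lemma perturbable_compact f (K : set M) : compact K ->
  (forall p, K p -> exists2 V, nbhs p V & perturbable f (V `&` K)) ->
  perturbable f K.
Proof.
move=> cK loc; apply: contrapT => nK.
pose F := [set A : set M | perturbable f (K `\` A)].
have FF : ProperFilter F.
  split; first by rewrite /F /= setD0.
  split.
  - by rewrite /F /= setDT; exact: perturbable0.
  - by move=> A B FA FB; rewrite /F /= setDIr; exact: perturbableU.
  - by move=> A B AB; apply: perturbable_sub; exact: setDS.
have FK : F K by rewrite /F /= setDv; exact: perturbable0.
have [p [Kp clp]] := cK F FF FK.
have [V pV VK] := loc p Kp.
have FV : F (~` V) by rewrite /F /= setDE setCK setIC.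
by have [q [nVq Vq]] := clp _ _ FV pV.
Qed.

(** Downward induction on m.  At a point whose stabilizer has more than m elements,
    the induction hypothesis gives regularity nearby; at the other points of the
    stratum, the nearby points of the stratum have the same stabilizer. *)
Lemma dense_stratum m (f : Cinf S k) O : equivariant f -> nbhs f O ->
  exists g, [/\ equivariant g, O g & forall q, stratum m q -> regular S g q].
Proof.
have [j] := ubnP (#|G|.+1 - m)%N; elim: j m f O => // j IHj m f O mj ef Of.
have [Gm|mG] := ltnP #|G| m.
  exists f; split=> //; first exact: nbhs_singleton Of.
  by move=> q; rewrite /stratum /= leqNgt (leq_ltn_trans (max_card _) Gm).
have [|f1 [ef1 Of1 f1reg]] := IHj m.+1 f _ _ ef (nbhs_interior Of).
  by move: mj; rewrite subSS subSn // ltnS.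
have cK : compact (stratum m).
  rewrite -[stratum m]setTI; apply: compact_closedI; last exact: closed_stratum.
  by case: cM.
suff pert : perturbable f1 (stratum m).
  have [g [eg Og greg]] := nbhs_singleton pert O ef1 Of1.
  by exists g; split=> //; exact: nbhs_singleton greg.
apply: perturbable_compact => // p pm.
have [pm1|pm1] := boolP (m < #|stab act p|)%N.
  have [[A B] /= [pA f1B] AB] := near_regular k_ge2 (f1reg p pm1).
  exists A => //; apply: (@filterS _ (nbhs f1)) (nbhs_interior f1B) => f' f'B O' ef' Of'.
  exists f'; split=> //; first exact: nbhs_singleton Of'.
  by apply: (@filterS _ (nbhs f')) f'B => h Bh q [Aq _]; apply: (AB (q, h)); split.
have pmE : #|stab act p| = m.
  by apply/eqP; rewrite eqn_leq pm andbT leqNgt.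
have [D [cD pD Dpert]] := local_perturbation hM sact k p.
pose C := D `&` [set q | forall h, h \in stab act p -> act q h = q].
have cC : compact C by apply: compact_closedI => //; exact: closed_fixed.
exists (D `&` [set q | stab act q \subset stab act p]).
  by apply: filterI => //; exact: stab_near.
have pC : perturbable f1 C.
  apply: (@filterE _ (nbhs f1)) => f' O' ef' Of'; have [g [eg Og greg]] := Dpert f' O' ef' Of'.
  exists g; split=> //; apply: near_regular_compact => // q [Dq qfix].
  exact: greg.
apply: perturbable_sub pC => q [[Dq qp] qm]; split=> // h hp; apply/stabP.
suff -> : stab act q = stab act p by [].
by apply/val_inj/eqP; rewrite /= eqEcard qp pmE.
Qed.

Lemma dense_morse : dense [set f : equivariant | morse S (set_val f)].
Proof.
move=> O [f Of] [A oA AE].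
have Af : nbhs (set_val f) A.
  by apply: open_nbhs_nbhs; split=> //; have : (set_val @^-1` A) f by rewrite AE.
have ef : equivariant (set_val f) by apply/set_mem; exact: (valP f).
have [g [eg Ag greg]] := @dense_stratum 0 _ _ ef Af.
exists (exist _ g (mem_set eg)); split; first by rewrite -AE.
by apply/morseP => [|p]; [exact: Cinf_smooth|exact: greg].
Qed.

End Strata.

Theorem theorem1p2 (R : realType) (n : nat) (M : topologicalType)
    (S : smooth_structure R n M) (closedM : closed_manifold M)
    (G : finGroupType) (act : {action G &-> M}) (smooth_act : smooth_action S act)
    (k : nat) (k_ge2 : (2 <= k)%N) :
  open [set f : equivariant_functions S act k | morse S (set_val f)] /\
  dense [set f : equivariant_functions S act k | morse S (set_val f)].
Proof.
split; first exact: open_morse.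
exact: dense_morse.
Qed.
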